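(* Let $\mathcal F_{A,t}$, $t\in[0,1/8]$, be the family of maps of $\mathcal M=(0,1)^2$ given by $$\mathcal F_{A,t}\begin{pmatrix}x\\ y\end{pmatrix}=\begin{pmatrix}\{x+y\}\\ \{x+(2-t)y\}\end{pmatrix},$$ and for $t>0$ small let $\mu_t$ be the measure determined by $\mu_t(\varphi)=\lim_{n\to\infty}m(\varphi\circ\mathcal F_{A,t}^n)$ for all $\varphi\in\mathcal C^0(\mathcal M)$. Then for any $\varphi\in\mathcal C^1(\mathcal M)$, $$\lim_{t\to0}\frac{\mu_t(\varphi)-m(\varphi)}{t}=\sum_{k\in\mathbb N_0}\left[m(\varphi)-\int_0^1(\varphi\circ\mathcal F_{A,0}^k)(s,s)\,ds\right].$$
   Context: $\{a\}$ is the fractional part of $a$; $m$ is Lebesgue measure on $\mathcal M=(0,1)^2$ and $m(\varphi)=\int_{\mathcal M}\varphi\,dm$; $\mathbb N_0=\{0,1,2,\dots\}$. $\mathcal C^k(\mathcal M)$ is the Banach space of differentiable functions on $\mathcal M$ whose derivatives of order $0,\dots,k$ extend continuously to the boundary. The map $\mathcal F_{A,t}$ is regarded as defined off the finite union of segments formed by $\partial\mathcal M$ and the lines $x+y=1$, $x+(2-t)y=1$, $x+(2-t)y=2$ in $\mathcal M$; its values there play no role. The paper establishes that there is $\varepsilon_0\in(0,1/8]$ such that for every $t\in(0,\varepsilon_0]$ the limits defining $\mu_t$ exist for all $\varphi\in\mathcal C^0(\mathcal M)$ and define a measure; the limit $t\to0$ is over $t\in(0,\varepsilon_0]$. *)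

(* Defs.v *)
From HB Require Import structures.
From mathcomp Require Export all_boot all_order all_algebra.
From mathcomp Require Export all_classical all_reals all_analysis.

Set Implicit Arguments.
Unset Strict Implicit.
Unset Printing Implicit Defensive.

Import Order.TTheory GRing.Theory Num.Theory.
Import numFieldNormedType.Exports.
Local Open Scope classical_set_scope.
Local Open Scope ring_scope.

Definition openM (R : realType) : set (R * R) := `]0, 1[ `*` `]0, 1[.

Definition closedM (R : realType) : set (R * R) := `[0, 1] `*` `[0, 1].

Definition frac (R : realType) (a : R) : R := a - (Num.floor a)%:~R.

(* The finitely many segments on which the formula takes values on the boundary
   of [openM R] form a null set; the formula is kept there, and it maps all of
   R * R into [0, 1)^2. *)
Definition FA (R : realType) (t : R) (z : R * R) : R * R :=
  (frac (z.1 + z.2), frac (z.1 + (2 - t) * z.2)).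

Notation plane R := (measurableTypeR R * measurableTypeR R)%type (only parsing).

Definition m2 (R : realType) : {measure set (plane R) -> \bar R} :=
  (@lebesgue_measure R \x @lebesgue_measure R)%E.

Definition integM (R : realType) (nu : {measure set (plane R) -> \bar R})
    (f : R * R -> R) : R :=
  Rintegral nu (@openM R) f.

(* A function of class C^0 or C^1 on the open square is identified with its
   unique continuous extension to the closed square; values outside the closed
   square are unconstrained and never used. *)
Definition C0M (R : realType) (phi : R * R -> R) : Prop :=
  {within @closedM R, continuous phi}.

Definition extends_continuously (R : realType) (g : R * R -> R) : Prop :=
  exists2 h : R * R -> R, C0M h & {in @openM R, g =1 h}.

Definition C1M (R : realType) (phi : R * R -> R) : Prop :=
  [/\ C0M phi,
      forall z, @openM R z -> differentiable phi z,
      extends_continuously (fun z => 'D_((1, 0) : R * R) phi z) &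
      extends_continuously (fun z => 'D_((0, 1) : R * R) phi z)].

Definition is_limit_measure (R : realType) (t : R)
    (nu : {measure set (plane R) -> \bar R}) : Prop :=
  forall phi : R * R -> R, C0M phi ->
    integM (m2 R) (phi \o iter n (FA t)) @[n --> \oo] --> integM nu phi.

Definition response_term (R : realType) (phi : R * R -> R) (k : nat) : R :=
  integM (m2 R) phi -
  Rintegral (@lebesgue_measure R) `[0, 1]
    (fun s : R => (phi \o iter k (FA 0)) (s, s)).

(* Main.v *)
(** On the torus, [F_t] is the cat map [F_0], which preserves [m], followed by
    [(u, v) |-> (u, u + (1 - t) {v - u})].  Hence, if [h_k w] denotes the
    integral of [phi o F_t^k] along the circle [y = x + w], then [m (phi o F_t^k)]
    is the mean of [h_k] over [[0, 1]] and [m (phi o F_t^(k+1))] its mean over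
    [[0, 1 - t]].  The difference of the two, divided by [t], is [1 / (1 - t)]
    times the mean of [h_k] over [[0, 1]] minus its mean over [[1 - t, 1]]; as
    [t -> 0] it tends to the [k]-th term of the series.

    It remains to bound the oscillation of [h_k] by [C q^k] uniformly in [t].
    [F_t] is discontinuous only across [y = 0], so the image of a segment that
    crosses the strip [0 < y < 1] is cut at integer heights into complete
    crossings and at most two incomplete pieces.  For the 1/2-Hoelder norm of
    segment integrals this gives a Lasota-Yorke inequality whose weak term only
    involves complete crossings.  The weak term is small after many steps:
    for small [t] the image is close to a long straight line whose slope is
    close to the golden mean, and such a line equidistributes. *)

Require Import Defs.
From mathcomp Require Import measurable_realfun ring lra.
Set Implicit Arguments.
Unset Strict Implicit.
Unset Printing Implicit Defensive.
Import Order.TTheory GRing.Theory Num.Theory.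
Import numFieldNormedType.Exports.
Local Open Scope classical_set_scope.
Local Open Scope ring_scope.

(** Why the exponent 1/2: an image segment of length [L d] has up to two incomplete pieces, and for
    an exponent [e <= 1] the powers of their lengths add up to at most [2^(1-e) (L d)^e]. Division
    by the stretch [L] leaves the factor [(2/L)^(1-e)]. It is below 1 when [e < 1] because
    [L >= 51/20 > 2]; [e = 1] would give no gain. Complete crossings gain nothing by this argument,
    hence the separate weak term.

    The mean of the observable is not known in advance, so every bound is relative to an unspecified
    centre [c], which may vary with the slope, the time and [t]. This is harmless: the difference
    quotients compare two means of the same function, and [c] cancels.

    Uniformity in [t] comes from the order of choices. The number of steps is fixed first; over so
    many steps the vertical jumps of size [t] add up to little once [t] is small. Equidistribution,
    too, is needed only up to a fixed length, so it holds for all slopes near the golden one,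
    rational or not.

    The sum over [k] arises by telescoping [m (phi o F_t^k)], and the geometric bound allows
    [t -> 0] term by term. *)

(** * Integrals over line segments and their norm *)

Section Leaf.
Variable R : realType.
Implicit Types (W : R -> R -> R -> R) (a b c r u t x h : R).

(* [W x h1 h2] stands for the integral over [h1 <= s <= h2] of [psi (x + a s, s)],
   where [psi] has period 1 in both variables. *)
Definition leaf a W : Prop :=
  [/\ forall x h1 h2 h3, h1 <= h2 -> h2 <= h3 -> W x h1 h3 = W x h1 h2 + W x h2 h3,
      forall x h1 h2, W (x + 1) h1 h2 = W x h1 h2 &
      forall x h1 h2, W x (h1 + 1) (h2 + 1) = W (x + a) h1 h2].

(* The constant [c] plays the role of the mean of [psi].  The large weight on the
   regularity in [x] absorbs the contribution of the first half of the bound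
   when the segment is moved (lemma [displace]). *)
Definition leaf_norm_le c r W : Prop :=
  (forall x h1 h2, 0 <= h1 -> h1 <= h2 -> h2 <= 1 ->
     `|W x h1 h2 - c * (h2 - h1)| <= r * Num.sqrt (h2 - h1)) /\
  (forall x x' h1 h2, 0 <= h1 -> h1 <= h2 -> h2 <= 1 ->
     `|W x h1 h2 - W x' h1 h2| <= 1000 * r * Num.sqrt `|x - x'|).

Lemma leaf_norm_ge0 c r W : leaf_norm_le c r W -> 0 <= r.
Proof.
move=> [H _]; have := H 0 0 1 (lexx 0) ler01 (lexx 1).
rewrite subr0 sqrtr1 !mulr1; exact: le_trans.
Qed.

Lemma sqrt_leP x y : 0 <= y -> x <= y ^+ 2 -> Num.sqrt x <= y.
Proof. by move=> y0 xy; rewrite -(ger0_norm y0) -sqrtr_sqr ler_wsqrtr. Qed.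

(** Concavity of the square root; the factor 2 is the price of two incomplete pieces. *)
Lemma sqrtD_le x y : 0 <= x -> 0 <= y ->
  Num.sqrt x + Num.sqrt y <= Num.sqrt (2 * (x + y)).
Proof.
move=> x0 y0.
have s0 : 0 <= Num.sqrt x + Num.sqrt y by rewrite addr_ge0 ?sqrtr_ge0.
rewrite -(ger0_norm s0) -sqrtr_sqr ler_wsqrtr //.
have := sqr_sqrtr x0; have := sqr_sqrtr y0.
set p := Num.sqrt x; set q := Num.sqrt y => <- <-.
by have := sqr_ge0 (p - q); nra.
Qed.

Lemma le_sqrt01 x : 0 <= x -> x <= 1 -> x <= Num.sqrt x.
Proof.
move=> x0 x1; have := sqr_sqrtr x0; have := sqrtr_ge0 x.
have : Num.sqrt x <= 1 by apply: sqrt_leP; lra.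
by move: (Num.sqrt x) => s *; nra.
Qed.

Lemma leaf0 a W x h : leaf a W -> W x h h = 0.
Proof.
by move=> [H _ _]; have := H x h h h (lexx h) (lexx h); lra.
Qed.

Lemma leaf_perN a W (n : nat) x h1 h2 : leaf a W -> W (x + n%:R) h1 h2 = W x h1 h2.
Proof.
move=> [_ H _]; elim: n x => [|n IH] x; first by rewrite addr0.
by rewrite -addn1 natrD addrA H IH.
Qed.

Lemma leaf_perZ a W (z : int) x h1 h2 : leaf a W -> W (x + z%:~R) h1 h2 = W x h1 h2.
Proof.
move=> lW; case: z => n; first exact: (leaf_perN _ _ _ _ lW).
by rewrite NegzE mulrNz -(leaf_perN n.+1 _ _ _ lW) subrK.
Qed.

Lemma leaf_shiftN a W (n : nat) x h1 h2 :
  leaf a W -> W x (h1 + n%:R) (h2 + n%:R) = W (x + n%:R * a) h1 h2.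
Proof.
move=> [_ _ H]; elim: n x => [|n IH] x; first by rewrite mul0r !addr0.
by rewrite -addn1 natrD !addrA H IH; congr W; ring.
Qed.

Lemma leaf_shiftZ a W (z : int) x h1 h2 :
  leaf a W -> W x (h1 + z%:~R) (h2 + z%:~R) = W (x + z%:~R * a) h1 h2.
Proof.
move=> lW; case: z => n; first exact: (leaf_shiftN _ _ _ _ lW).
rewrite NegzE mulrNz.
have <- : W (x + - n.+1%:R * a) (h1 - n.+1%:R + n.+1%:R) (h2 - n.+1%:R + n.+1%:R) = W x (h1 - n.+1%:R) (h2 - n.+1%:R).
  by rewrite (leaf_shiftN _ _ _ _ lW); congr W; ring.
by rewrite !subrK.
Qed.

Lemma leaf_normalize a W x h : leaf a W ->
  exists x' g, 0 <= g < 1 /\ forall d, W x h (h + d) = W x' g (g + d).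
Proof.
move=> lW; pose z := Num.floor h.
exists (x + z%:~R * a), (h - z%:~R); split.
  have := floor_le h; have := lt_succ_floor h; rewrite -/z intrD1; lra.
move=> d; rewrite -(leaf_shiftZ z _ _ _ lW); congr W; ring.
Qed.

Lemma cells_bound (D : R -> R -> R) (n : nat) e :
  0 <= e ->
  (forall h1 h2 h3, 0 <= h1 -> h1 <= h2 -> h2 <= h3 -> h3 <= n%:R -> D h1 h3 = D h1 h2 + D h2 h3) ->
  (forall (i : nat) h1 h2, (i < n)%N -> i%:R <= h1 -> h1 <= h2 -> h2 <= i%:R + 1 -> `|D h1 h2| <= e) ->
  forall h1 h2, 0 <= h1 -> h1 <= h2 -> h2 <= n%:R -> `|D h1 h2| <= n%:R * e.
Proof.
move=> e0; elim: n => [|n IH] add cell h1 h2 h10 h12 h2n.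
  have E : h1 = 0 by move: h2n; rewrite mulr0n; lra.
  have -> : h2 = h1 by move: h2n; rewrite mulr0n; lra.
  have D0 : D h1 h1 = D h1 h1 + D h1 h1 by apply: add => //; rewrite E.
  have -> : D h1 h1 = 0 by lra.
  by rewrite normr0 mul0r.
have IH' : forall h1 h2, 0 <= h1 -> h1 <= h2 -> h2 <= n%:R -> `|D h1 h2| <= n%:R * e.
  apply: IH => [*|i k1 k2 ik *]; last by apply: (cell i) => //; apply: ltnW.
  by apply: add => //; rewrite -addn1 natrD; lra.
have [h2n'|/ltW nh2] := leP h2 n%:R.
  by apply: (le_trans (IH' _ _ _ _ _)) => //; rewrite -addn1 natrD; nra.
have cl : forall k1 k2, n%:R <= k1 -> k1 <= k2 -> k2 <= n.+1%:R -> `|D k1 k2| <= e.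
  by move=> k1 k2 *; apply: (cell n) => //; rewrite natr1.
have n0 : 0 <= n%:R :> R by rewrite ler0n.
have [h1n|/ltW nh1] := leP n%:R h1.
  by apply: (le_trans (cl _ _ _ _ _)) => //; rewrite -addn1 natrD; nra.
rewrite (add h1 n%:R h2) //; apply: (le_trans (ler_normD _ _)).
by rewrite -addn1 natrD mulrDl mul1r lerD ?IH' ?cl.
Qed.


Lemma crossings_bound a W c u (n : nat) x : leaf a W ->
  (forall x, `|W x 0 1 - c| <= u) -> `|W x 0 n%:R - c * n%:R| <= n%:R * u.
Proof.
move=> lW Hu; elim: n => [|n IH]; first by rewrite (leaf0 _ _ lW) mulr0 mul0r subrr normr0.
have -> : W x 0 n.+1%:R = W x 0 n%:R + W (x + n%:R * a) 0 1.
  rewrite -(leaf_shiftN n x 0 1 lW) add0r [1 + _]addrC natr1.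
  by have [H _ _] := lW; apply: H; rewrite ?ler0n // ler_nat.
rewrite -natr1 [X in `|X|](_ : _ = (W x 0 n%:R - c * n%:R) + (W (x + n%:R * a) 0 1 - c)); last by ring.
by apply: (le_trans (ler_normD _ _)); rewrite mulrDl mul1r lerD.
Qed.

(** Only the end pieces are charged to [r]. Each complete crossing is charged to [u], and there are
    at most [d] of them. *)
Lemma segment_bound a W c r u x h d : leaf a W -> leaf_norm_le c r W ->
  (forall x, `|W x 0 1 - c| <= u) -> 0 <= d ->
  `|W x h (h + d) - c * d| <= r * Num.sqrt (2 * d) + u * d.
Proof.
move=> lW bW Hu d0.
have r0 := leaf_norm_ge0 bW.
have u0 : 0 <= u by apply: le_trans (Hu 0).
have ud0 : 0 <= u * d by rewrite mulr_ge0.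
have [x' [g [/andP[g0 g1] ->]]] := leaf_normalize x h lW.
have [H1 _] := bW.
have [gd|/ltW gd] := leP (g + d) 1.
  have := H1 x' g (g + d) g0; rewrite lerDl => /(_ d0 gd).
  have -> : g + d - g = d by ring.
  move=> /le_trans -> //.
  apply: (@le_trans _ _ (r * Num.sqrt (2 * d))); last by rewrite lerDl.
  by rewrite ler_wpM2l // ler_wsqrtr //; lra.
have /andP[] := truncn_itv (le_trans ler01 gd).
(* [m.+1] is the integer part of [g + d]: a piece from [g] to 1, then [m] complete crossings, then a
   piece above [m.+1]. *)
case E: (Num.truncn _) => [|m] mg gm; first by move: gm; lra.
have [add _ _] := lW.
have m1 : 1 <= m.+1%:R :> R by rewrite ler1n.
rewrite (add x' g 1 (g + d)) //; last by lra.
rewrite (add x' 1 m.+1%:R (g + d)) //.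
have e1 : `|W x' g 1 - c * (1 - g)| <= r * Num.sqrt (1 - g) by apply: H1 => //; lra.
have e2 : `|W x' 1 m.+1%:R - c * m%:R| <= m%:R * u.
  have := crossings_bound m (x' + 1%:R * a) lW Hu.
  by rewrite -(leaf_shiftN 1 _ _ _ lW) add0r natr1.
have e3 : `|W x' m.+1%:R (g + d) - c * (g + d - m.+1%:R)| <= r * Num.sqrt (g + d - m.+1%:R).
  have := H1 (x' + m.+1%:R * a) 0 (g + d - m.+1%:R) (lexx 0).
  rewrite -(leaf_shiftN m.+1 _ _ _ lW) add0r subrK subr0; apply.
    by rewrite subr_ge0.
  by move: gm; rewrite -[m.+2%:R]natr1; lra.
have sq : Num.sqrt (1 - g) + Num.sqrt (g + d - m.+1%:R) <= Num.sqrt (2 * d).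
  apply: (le_trans (sqrtD_le _ _)); rewrite ?subr_ge0 ?(ltW g1) //.
  by rewrite ler_wsqrtr //; lra.
have mu : m%:R * u <= u * d.
  by rewrite mulrC ler_wpM2l //; move: mg; rewrite -natr1; lra.
have := ler_wpM2l r0 sq; rewrite mulrDr => rs.
move: e1 e2 e3 mu rs; rewrite -natr1; rewrite !ler_norml.
set p := r * _; set q := r * _; set w := r * _.
set mu := m%:R * u; set ud := u * d.
set X := W _ _ _; set Y := W _ _ _; set Z := W _ _ _.
move=> *; apply/andP; split; lra.
Qed.

Lemma leaf_norm_crossing c r W x : leaf_norm_le c r W -> `|W x 0 1 - c| <= r.
Proof.
move=> [H _]; have := H x 0 1 (lexx 0) ler01 (lexx 1).
by rewrite subr0 sqrtr1 !mulr1.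
Qed.

(** Parallel lines keep their horizontal distance, so every unit cell contributes the same error. *)
Lemma base_change a W c r x x' h1 h2 (n : nat) : leaf a W -> leaf_norm_le c r W ->
  0 <= h1 -> h1 <= h2 -> h2 <= n%:R ->
  `|W x h1 h2 - W x' h1 h2| <= n%:R * (1000 * r * Num.sqrt `|x - x'|).
Proof.
move=> lW bW; have r0 := leaf_norm_ge0 bW; have [add _ _] := lW; have [_ H2] := bW.
apply: (@cells_bound (fun h1 h2 => W x h1 h2 - W x' h1 h2)).
- by apply: mulr_ge0 (sqrtr_ge0 _); lra.
- by move=> k1 k2 k3 _ k12 k23 _; rewrite !(add _ k1 k2 k3) //; ring.
- move=> i k1 k2 _ ik k12 k2i.
  have -> : `|x - x'| = `|(x + i%:R * a) - (x' + i%:R * a)|.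
    by congr (`|_|); ring.
  rewrite -{1}(subrK i%:R k1) -{1}(subrK i%:R k2) -{2}(subrK i%:R k1) -{2}(subrK i%:R k2).
  by rewrite !(leaf_shiftN i _ _ _ lW); apply: H2; lra.
Qed.

Lemma displace a W c r z z' A B d : leaf a W -> leaf_norm_le c r W ->
  0 <= d -> A <= B -> B <= A + 3 ->
  `|W z A B - W z' (A + d) (B + d)| <=
    4 * (1000 * r * Num.sqrt `|z - z'|) + 2 * (r * Num.sqrt (2 * d) + r * d).
Proof.
move=> lW bW d0 AB BA.
have [add _ _] := lW.
(* A segment of height at most 3 lies in four consecutive unit cells. *)
have e1 : `|W z A B - W z' A B| <= 4 * (1000 * r * Num.sqrt `|z - z'|).
  pose k := Num.floor A.
  have := floor_le A; have := lt_succ_floor A; rewrite -/k intrD1 => kA Ak.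
  have -> : `|z - z'| = `|(z + k%:~R * a) - (z' + k%:~R * a)|.
    by congr (`|_|); ring.
  rewrite -{1}(subrK k%:~R A) -{1}(subrK k%:~R B) -{2}(subrK k%:~R A) -{2}(subrK k%:~R B).
  rewrite !(leaf_shiftZ k _ _ _ lW).
  by apply: (base_change (n := 4) _ _ lW bW); lra.
(* On one line, the integrals over [[A, B]] and [[A + d, B + d]] differ by two end pieces of length
   [d], whose main terms [c * d] cancel. *)
have S := fun x h => segment_bound x h lW bW (fun x => leaf_norm_crossing x bW) d0.
have := S z' A; have := S z' B.
have := add z' A B (B + d) AB; rewrite lerDl => /(_ d0) E1.
have := add z' A (A + d) (B + d); rewrite lerDl lerD2r => /(_ d0 AB) E2.
move: e1; rewrite !ler_norml.
set p := 1000 * r * _; set q := r * _; set w := r * _.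
by move=> *; apply/andP; split; lra.
Qed.

End Leaf.

(** * One application of the map *)

Section Step.
Variable R : realType.
Implicit Types (W : R -> R -> R -> R) (a b c r u t x h : R).

Definition stretch t a : R := a + 2 - t.
Definition slope t a : R := (a + 1) / stretch t a.

(* For [0 <= s < 1], [F_t] maps [(x + a s, s)] to the point of height
   [x + stretch t a * s] on the line of slope parameter [slope t a] through
   [((1 - slope t a) x, 0)]. *)
Definition pullback t a W W' : Prop :=
  forall x h1 h2, 0 <= h1 -> h1 <= h2 -> h2 <= 1 ->
    W x h1 h2 = (stretch t a)^-1 *
      W' ((1 - slope t a) * x) (x + stretch t a * h1) (x + stretch t a * h2).

(** A range invariant under [slope t]. It contains 1, the parameter of the circles [y = x + w], and
    [gold], and it keeps the stretch above 2. *)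
Definition slope_ok a := 3/5 <= a <= 1.
Definition time_ok t := 0 <= t <= 1/20.

Lemma stretch_bounds t a : time_ok t -> slope_ok a -> 51/20 <= stretch t a <= 3.
Proof. by rewrite /stretch => /andP[? ?] /andP[? ?]; apply/andP; split; lra. Qed.

Lemma slope_ok_slope t a : time_ok t -> slope_ok a -> slope_ok (slope t a).
Proof.
move=> ht ha; have /andP[l1 l2] := stretch_bounds ht ha.
have l0 : 0 < stretch t a by lra.
move: ht ha => /andP[? ?] /andP[? ?].
rewrite /slope_ok /slope ler_pdivlMr // ler_pdivrMr // /stretch.
by apply/andP; split; lra.
Qed.

Lemma slope_stretch t a : time_ok t -> slope_ok a ->
  slope t a * stretch t a = a + 1.
Proof.
move=> ht ha; have /andP[l1 l2] := stretch_bounds ht ha.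
by rewrite /slope divfK // gt_eqF //; lra.
Qed.

Lemma sqrt2_le : Num.sqrt 2 <= 3/2 :> R.
Proof. by apply: sqrt_leP; lra. Qed.

(** For [E = 0] this is [4000 * 0.6263 + 3 + 2 = 2510.2 <= 990 * 51/20 = 2524.5]. The summand
    [3 + 2] does not scale with the weight 1000 on the horizontal regularity; any weight above about
    260 would make room for it. *)
Lemma pullback_arith (A B C D E F : R) : 0 <= A -> F <= A -> B <= A * (6263/10000) ->
  C <= A * (3/2) -> A * (51/20) <= D -> 0 <= E ->
  4000 * B + 2 * C + 2 * F <= 990 * D + 1000 * E.
Proof. by move=> *; lra. Qed.

(* The image segment has at most two incomplete pieces, whose square roots of
   lengths add up to at most [sqrt (2 stretch)] times that of the original one:
   the factor 99/100 exceeds [sqrt (2 / stretch)]. *)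
Lemma leaf_norm_pullback t a W W' c r u : time_ok t -> slope_ok a ->
  leaf (slope t a) W' -> pullback t a W W' -> leaf_norm_le c r W' ->
  (forall x, `|W' x 0 1 - c| <= u) -> leaf_norm_le c (99/100 * r + u) W.
Proof.
move=> ht ha lW im bW Hu.
have r0 := leaf_norm_ge0 bW.
have u0 : 0 <= u by apply: le_trans (Hu 0).
have /andP[l1 l2] := stretch_bounds ht ha.
have sl := slope_stretch ht ha.
have /andP[s1 s2] := slope_ok_slope ht ha.
have l0 : 0 < stretch t a by lra.
have li0 : 0 < (stretch t a)^-1 by rewrite invr_gt0.
have S : forall x h1 h2 : R, 0 <= h1 -> h1 <= h2 -> h2 <= 1 ->
     `|W x h1 h2 - c * (h2 - h1)| <= (99/100 * r + u) * Num.sqrt (h2 - h1).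
  move=> x h1 h2 h10 h12 h21; rewrite im //.
  set z := (1 - _) * x; set L := stretch t a in l0 li0 l1 l2 *.
  have d0 : 0 <= h2 - h1 by lra.
  have d1 : h2 - h1 <= 1 by lra.
  have Ld0 : 0 <= L * (h2 - h1) by rewrite mulr_ge0 // ltW.
  have := segment_bound z (x + L * h1) lW bW Hu Ld0.
  have -> : x + L * h1 + L * (h2 - h1) = x + L * h2 by ring.
  have -> : 2 * (L * (h2 - h1)) = (2 * L) * (h2 - h1) by ring.
  rewrite sqrtrM; last by lra.
  have sL : Num.sqrt (2 * L) <= 99/100 * L.
    apply: sqrt_leP; first by lra.
    nra.
  have sd0 := sqrtr_ge0 (h2 - h1).
  have sd1 := le_sqrt01 d0 d1.
  set s := Num.sqrt (h2 - h1) in sd0 sd1 *.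
  set V := W' _ _ _.
  move=> B.
  have -> : L^-1 * V - c * (h2 - h1) = L^-1 * (V - c * (L * (h2 - h1))).
    by field; rewrite gt_eqF.
  rewrite normrM (gtr0_norm li0) -ler_pdivlMl ?invr_gt0 // invrK.
  apply: (le_trans B).
  have -> : L * ((99/100 * r + u) * s) = r * (99/100 * L * s) + u * (L * s) by ring.
  apply: lerD; rewrite ler_wpM2l //; first by rewrite ler_wpM2r.
  by rewrite ler_wpM2l // ltW.
split=> // x x' h1 h2 h10 h12 h21.
wlog xx : x x' / x <= x'.
  move=> wl; have [xx|/ltW xx] := leP x x'; first exact: wl.
  by rewrite distrC [X in Num.sqrt X]distrC; exact: wl.
have d0 : 0 <= x' - x by lra.
have -> : `|x - x'| = x' - x by rewrite distrC ger0_norm.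
set d := x' - x in d0 *.
have sd0 := sqrtr_ge0 d.
(* For [d >= 1] the bound [S], applied to each of the two segments, is enough. *)
have [d1|/ltW d1] := leP d 1; last first.
  have s1' : 1 <= Num.sqrt d by rewrite -[X in X <= _]sqrtr1 ler_wsqrtr.
  have := S x h1 h2 h10 h12 h21; have := S x' h1 h2 h10 h12 h21.
  have : Num.sqrt (h2 - h1) <= 1 by apply: sqrt_leP; lra.
  have : 0 <= Num.sqrt (h2 - h1) by exact: sqrtr_ge0.
  set q := Num.sqrt (h2 - h1) => q0 q1.
  set s := Num.sqrt d in sd0 s1' *.
  have k0 : 0 <= 99/100 * r + u by lra.
  set k := _ + u in k0 *.
  have kq : k * q <= k by nra.
  have ks : 2 * k <= 1000 * k * s by nra.
  move: kq ks; set kq := k * q; set ks := 1000 * k * s.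
  by rewrite !ler_norml => *; apply/andP; split; lra.
rewrite !im // -mulrBr normrM (gtr0_norm li0) -ler_pdivlMl ?invr_gt0 // invrK.
have E0 : stretch t a = a + 2 - t by [].
have /andP[t0 _] := ht.
set L := stretch t a in l0 li0 l1 l2 sl E0 *.
set s := slope t a in s1 s2 sl *.
(* Moving a segment by [d] to the right moves the foot of its image by [(1 - s) d] and all image
   heights by [d]. *)
have := displace ((1 - s) * x) ((1 - s) * x') (A := x + L * h1) (B := x + L * h2) lW bW d0.
have -> : x + L * h1 + d = x' + L * h1 by rewrite /d; ring.
have -> : x + L * h2 + d = x' + L * h2 by rewrite /d; ring.
move=> /(_ _ _)/le_trans -> //; [by rewrite lerD2l ler_pM2l | by nra |].
have -> : `|(1 - s) * x - (1 - s) * x'| = (1 - s) * d.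
  rewrite -mulrBr normrM [`|x - x'|]distrC (ger0_norm d0) ger0_norm //; lra.
rewrite sqrtrM; last by lra.
rewrite sqrtrM //.
have b1 : Num.sqrt (1 - s) <= 6263/10000.
  (* The product equals [1 - t], the determinant of the linear part of the map. *)
  have sL : (1 - s) * L <= 1 by rewrite mulrBl mul1r sl E0; lra.
  have : (1 - s) * (51/20) <= (1 - s) * L by rewrite ler_wpM2l //; lra.
  by move=> ?; apply: sqrt_leP; lra.
have b2 := sqrt2_le.
have b3 := le_sqrt01 d0 d1.
have b4 := sqrtr_ge0 (1 - s); have b5 := sqrtr_ge0 (2 : R).
set q := Num.sqrt d in sd0 b3 *.
set p := Num.sqrt (1 - s) in b1 b4 *.
set v := Num.sqrt 2 in b2 b5 *.
have rq0 : 0 <= r * q by rewrite mulr_ge0.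
have rd : r * d <= r * q by rewrite ler_wpM2l.
have pq : r * q * p <= r * q * (6263/10000) by rewrite ler_wpM2l.
have vq : r * q * v <= r * q * (3/2) by rewrite ler_wpM2l.
have Lq : r * q * (51/20) <= r * q * L by rewrite ler_wpM2l.
have uq : 0 <= L * u * q by rewrite !mulr_ge0 // ltW.
have -> : 4 * (1000 * r * (p * q)) + 2 * (r * (v * q) + r * d) =
  4000 * (r * q * p) + 2 * (r * q * v) + 2 * (r * d) by ring.
have -> : L * (1000 * (99/100 * r + u) * q) = 990 * (r * q * L) + 1000 * (L * u * q).
  by field.
exact: (pullback_arith rq0 rd pq vq Lq uq).
Qed.

(* For [t = 0] the identity of [pullback] holds for all heights; for [t > 0],
   each time an integer height is crossed the image jumps vertically by [t]. *)
Lemma pullback_line t a W W' c r (H : nat) x h1 h2 : time_ok t -> slope_ok a ->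
  leaf a W -> leaf (slope t a) W' -> pullback t a W W' -> leaf_norm_le c r W' ->
  H%:R * t <= 1 -> 0 <= h1 -> h1 <= h2 -> h2 <= H%:R ->
  `|W x h1 h2 - (stretch t a)^-1 *
     W' ((1 - slope t a) * x) (x + stretch t a * h1) (x + stretch t a * h2)|
  <= H%:R * (2000 * r * Num.sqrt (H%:R * t)).
Proof.
move=> ht ha lW lW' im bW Ht1 h10 h12 h2H.
have r0 := leaf_norm_ge0 bW.
have /andP[l1 l2] := stretch_bounds ht ha.
have sl := slope_stretch ht ha.
have /andP[s1 s2] := slope_ok_slope ht ha.
have /andP[t0 _] := ht.
have l0 : 0 < stretch t a by lra.
have li0 : 0 < (stretch t a)^-1 by rewrite invr_gt0.
have [add _ _] := lW; have [add' _ _] := lW'.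
move: h1 h2 h10 h12 h2H.
apply: (@cells_bound _ (fun h1 h2 => W x h1 h2 - (stretch t a)^-1 *
     W' ((1 - slope t a) * x) (x + stretch t a * h1) (x + stretch t a * h2))).
- by apply: mulr_ge0 (sqrtr_ge0 _); lra.
- move=> k1 k2 k3 k0 k12 k23 _; rewrite (add x k1 k2 k3) //.
  rewrite (add' _ (x + stretch t a * k1) (x + stretch t a * k2)); first by ring.
    by rewrite lerD2l ler_pM2l.
  by rewrite lerD2l ler_pM2l.
move=> n k1 k2 nH nk k12 k2n.
rewrite -{1}(subrK n%:R k1) -{1}(subrK n%:R k2) (leaf_shiftN n _ _ _ lW).
rewrite im; try lra.
rewrite -mulrBr normrM (gtr0_norm li0) -ler_pdivlMl ?invr_gt0 // invrK.
have E0 : stretch t a = a + 2 - t by [].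
set L := stretch t a in l0 li0 l1 l2 sl E0 *.
set s := slope t a in s1 s2 sl *.
pose d := n%:R * t.
have d0 : 0 <= d by rewrite mulr_ge0 ?ler0n.
have dH : d <= H%:R * t by rewrite ler_wpM2r // ler_nat ltnW.
set z' := (1 - s) * (x + n%:R * a).
(* The true image of the cell starting at height [n] lies at heights
   [x + n a + L (k - n) = x + L k - 2 n + d]. Lowering the straight image by the integer [2 n] moves
   its foot to [z' + s d] modulo 1, since [s (a + 2 - t) = a + 1]. *)
have -> : W' ((1 - s) * x) (x + L * k1) (x + L * k2) =
  W' (z' + s * d) (x + L * k1 - (2 * n)%:R) (x + L * k2 - (2 * n)%:R).
  rewrite -{1}(subrK (2 * n)%:R (x + L * k1)) -{1}(subrK (2 * n)%:R (x + L * k2)).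
  rewrite (leaf_shiftN (2 * n) _ _ _ lW') -(leaf_perN n (z' + _) _ _ lW').
  congr (W' _ _ _); rewrite natrM /z' /d.
  have -> : s * (n%:R * t) = n%:R * (s * (a + 2)) - n%:R * (a + 1).
    by rewrite -sl E0; ring.
  by rewrite -/s; ring.
rewrite distrC.
have := displace (z' + s * d) z' (A := x + L * k1 - (2 * n)%:R) (B := x + L * k2 - (2 * n)%:R) lW' bW d0.
have <- : x + n%:R * a + L * (k1 - n%:R) = x + L * k1 - (2 * n)%:R + d.
  by rewrite natrM /d E0; ring.
have <- : x + n%:R * a + L * (k2 - n%:R) = x + L * k2 - (2 * n)%:R + d.
  by rewrite natrM /d E0; ring.
move=> /(_ _ _)/le_trans -> //; [by rewrite lerB ?lerD2l ?ler_pM2l| by nra |].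
have -> : z' + s * d - z' = s * d by ring.
have b1 : Num.sqrt `|s * d| <= Num.sqrt (H%:R * t).
  by rewrite ler_wsqrtr // ger0_norm ?mulr_ge0 //; nra.
have b2 : Num.sqrt (2 * d) <= 3/2 * Num.sqrt (H%:R * t).
  rewrite sqrtrM // ler_pM ?sqrtr_ge0 //; last by rewrite ler_wsqrtr.
  by apply: sqrt_leP; lra.
have Ht0 : 0 <= H%:R * t by lra.
have b3 : d <= Num.sqrt (H%:R * t) by apply: (le_trans dH); exact: le_sqrt01.
set q := Num.sqrt (H%:R * t) in b1 b2 b3 *.
have q0 : 0 <= q by exact: sqrtr_ge0.
have := ler_wpM2l r0 b1; have := ler_wpM2l r0 b2; have := ler_wpM2l r0 b3.
have rq0 : 0 <= r * q by rewrite mulr_ge0.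
have : r * q * (51/20) <= r * q * L by rewrite ler_wpM2l.
rewrite [r * (_ * q)]mulrCA -!mulrA.
rewrite [L * _](_ : _ = 2000 * (r * (q * L))); last by ring.
rewrite !mulrA; move: rq0; rewrite -!mulrA.
set A := r * q; set B := r * Num.sqrt _; set C := r * Num.sqrt _; set D := r * d.
set E := r * (q * L).
have -> : r * (q * (51/20)) = A * (51/20) by rewrite /A mulrA.
by lra.
Qed.

End Step.

(** * Equidistribution of lines with slope parameter near the golden mean *)

Section Equidistribution.
Variable R : realType.
Implicit Types (W : R -> R -> R -> R) (a b c r u t x h : R).

(** The positive fixed point of [slope 0]: [gold * (gold + 2) = gold + 1]. *)
Definition gold : R := (Num.sqrt 5 - 1) / 2.

Lemma gold_sqr : gold ^+ 2 = 1 - gold.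
Proof.
have : Num.sqrt 5 ^+ 2 = 5 :> R by rewrite sqr_sqrtr.
by rewrite /gold => s; have -> : (Num.sqrt 5 : R) ^+ 2 = 5 -> ((Num.sqrt 5 - 1) / 2) ^+ 2 = 1 - (Num.sqrt 5 - 1) / 2 :> R by move=> {}s; field: s.
Qed.

Lemma gold_bounds : 3/5 <= gold <= 5/8.
Proof.
have s0 : 0 <= Num.sqrt 5 :> R by exact: sqrtr_ge0.
have s2 : Num.sqrt 5 ^+ 2 = 5 :> R by rewrite sqr_sqrtr.
by rewrite /gold; apply/andP; split; nra.
Qed.

(** For odd powers both coefficients have the right sign: [u] rotations by [gold] amount to one
    rotation by a small positive number. *)
Lemma gold_pow_span n : exists u v : nat, gold ^+ (n.*2.+1) = u%:R * gold - v%:R.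
Proof.
elim: n => [|n [u [v E]]]; first by exists 1%N, 0%N; rewrite expr1; ring.
exists (2 * u + v)%N, (u + v)%N.
rewrite doubleS exprS [gold ^+ n.*2.+2]exprS E mul2n -addnn !natrD.
have := gold_sqr; move: gold => g g2.
have -> : g * (g * (u%:R * g - v%:R)) = g ^+ 2 * (u%:R * g - v%:R) by ring.
rewrite g2.
have -> : (1 - g) * (u%:R * g - v%:R) = u%:R * g - v%:R - u%:R * g ^+ 2 + v%:R * g by ring.
by rewrite g2; ring.
Qed.

(** Since [b] may be rational, density is proved for [gold] and transferred: only [M] steps occur,
    and [eta] is chosen so that over them the error [b - gold] adds up to at most [th / 2]. *)
Lemma rotation_density (th : R) : 0 < th ->
  exists (M : nat) (eta : R), 0 < eta /\
   forall b, `|b - gold| <= eta -> forall z z', exists (m : nat) (p : int),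
     (m <= M)%N /\ `|z + m%:R * b - z' - p%:~R| <= th.
Proof.
move=> th0; have /andP[g1 g2] := gold_bounds.
have [n Hn] : exists n, gold ^+ n.*2.+1 <= th / 2.
  have [N HN] : exists N : nat, 2 / th < N%:R.
    by exists (Num.truncn (2 / th)).+1; rewrite truncnS_gt //.
  exists N; apply: (@le_trans _ _ ((1/2) ^+ N)).
    rewrite -[N.*2.+1]/(N.*2.+1); apply: (@le_trans _ _ ((gold ^+ 2) ^+ N)).
      rewrite -exprM mul2n exprS ler_piMl ?exprn_ge0 //; lra.
    by apply: lerXn2r; rewrite ?nnegrE ?exprn_ge0 ?gold_sqr; lra.
  have : N%:R <= 2 ^+ N :> R by rewrite -natrX ler_nat ltnW // ltn_expl.
  have p0 : 0 < 2 ^+ N :> R by rewrite exprn_gt0.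
  rewrite mul1r exprVn => HN2.
  rewrite -[th / 2]invrK invf_div lef_pV2 ?posrE //; last by rewrite divr_gt0.
  lra.
have [u [v E]] := gold_pow_span n.
set s := gold ^+ _ in Hn E.
have s0 : 0 < s by rewrite exprn_gt0 //; lra.
(* Blocks of [u] steps advance by [s]; about [1 / s] blocks go once around the circle. *)
pose M := (u * (Num.truncn s^-1).+1)%N.
exists M, (th / 2 / (M%:R + 1)); split.
  by rewrite !divr_gt0 // ltr_wpDl // ler0n.
move=> b hb z z'.
pose d := z' - z - (Num.floor (z' - z))%:~R.
have d0 : 0 <= d by have := floor_le (z' - z); rewrite /d; lra.
have d1 : d < 1 by have := lt_succ_floor (z' - z); rewrite /d intrD1; lra.
pose i := Num.truncn (d / s).
have /andP[i1 i2] := @truncn_itv _ (d / s) (divr_ge0 d0 (ltW s0)).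
rewrite -/i in i1 i2.
rewrite ler_pdivlMr // in i1; rewrite ltr_pdivrMr // -natr1 mulrDl mul1r in i2.
have iM : (i * u <= M)%N.
  rewrite /M mulnC leq_mul // leqW //; apply: le_truncn.
  by rewrite -[leRHS]mul1r ler_wpM2r ?invr_ge0 ?(ltW s0) ?(ltW d1).
exists (i * u)%N, (- Num.floor (z' - z) + Posz (i * v)%N); split => //.
have -> : z + (i * u)%:R * b - z' - (- Num.floor (z' - z) + Posz (i * v))%:~R =
   (i%:R * s - d) + (i * u)%:R * (b - gold).
  by rewrite E /d intrD mulrNz -pmulrn !natrM; ring.
apply: (le_trans (ler_normD _ _)).
have e1 : `|i%:R * s - d| <= th / 2 by rewrite ler_norml; lra.
have e2 : `|(i * u)%:R * (b - gold)| <= th / 2.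
  rewrite normrM normr_nat.
  have M0 : 0 < M%:R + 1 :> R by rewrite ltr_wpDl // ler0n.
  move: hb; rewrite ler_pdivlMr // => hb.
  apply: le_trans hb; rewrite mulrC ler_wpM2l //.
  by rewrite ler_wpDr // ler_nat.
lra.
Qed.


Definition recurs (b th : R) (M : nat) : Prop :=
  forall z z', exists (m : nat) (p : int), (m <= M)%N /\ `|z + m%:R * b - z' - p%:~R| <= th.

(* The two lines agree up to a small horizontal shift once the first one has been
   followed for [m] crossings. *)
Lemma line_close b W c r th (M J : nat) z z' : leaf b W -> leaf_norm_le c r W -> recurs b th M ->
  `|W z 0 J%:R - W z' 0 J%:R| <= 2 * M%:R * r + J%:R * (1000 * r * Num.sqrt th).
Proof.
move=> lW bW rec; have r0 := leaf_norm_ge0 bW.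
have [m [p [mM zp]]] := rec z z'.
have [add _ _] := lW.
have fr := crossings_bound m _ lW (fun x => leaf_norm_crossing x bW).
have e1 := fr z; have e2 := fr (z + J%:R * b).
rewrite -(leaf_shiftN J z 0 m%:R lW) add0r in e2.
have n0 (k : nat) : 0 <= k%:R :> R by exact: ler0n.
have E1 := add z 0 m%:R (m%:R + J%:R) (n0 m); rewrite lerDl in E1; have {}E1 := E1 (n0 J).
have E2 := add z 0 J%:R (m%:R + J%:R) (n0 J); rewrite lerDr in E2; have {}E2 := E2 (n0 m).
have E3 : W z m%:R (m%:R + J%:R) = W (z + m%:R * b - p%:~R) 0 J%:R.
  have := leaf_shiftN m z 0 J%:R lW; rewrite add0r [J%:R + _]addrC => ->.
  by rewrite -(leaf_perZ p (_ - _) _ _ lW) subrK.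
have e3 := @base_change _ b W c r (z + m%:R * b - p%:~R) z' 0 J%:R J lW bW (lexx 0) (n0 J) (lexx _).
have e4 : J%:R * (1000 * r * Num.sqrt `|z + m%:R * b - p%:~R - z'|) <= J%:R * (1000 * r * Num.sqrt th).
  have k0 : 0 <= 1000 * r by lra.
  rewrite ler_wpM2l // (ler_wpM2l k0) // ler_wsqrtr //.
  by rewrite (_ : _ - z' = z + m%:R * b - z' - p%:~R) //; ring.
have e5 : m%:R * r <= M%:R * r by rewrite ler_wpM2r // ler_nat.
rewrite -mulrA; move: e1 e2 e3 e4 e5 E1 E2 E3.
set X := J%:R * _; set Y := J%:R * _; set p1 := m%:R * r; set p2 := M%:R * r.
rewrite !ler_norml; clear => *; apply/andP; split; lra.
Qed.

(** Modulo 1 the starting height is some [h < 1]; passing to height 0 exchanges two pieces of height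
    [h], hence the extra [2 * r]. *)
Lemma chunk_close b W c r th (M J : nat) z g : leaf b W -> leaf_norm_le c r W -> recurs b th M ->
  `|W z g (g + J%:R) - W 0 0 J%:R| <=
    (2 * M%:R + 2) * r + J%:R * (1000 * r * Num.sqrt th).
Proof.
move=> lW bW rec; have r0 := leaf_norm_ge0 bW.
have [x [h [/andP[h0 h1] ->]]] := leaf_normalize z g lW.
have n0 (k : nat) : 0 <= k%:R :> R by exact: ler0n.
have e1 := line_close J x 0 lW bW rec.
have [add _ _] := lW.
have E1 := add x 0 h (h + J%:R) h0; rewrite lerDl in E1; have {}E1 := E1 (n0 J).
have E2 := add x 0 J%:R (h + J%:R) (n0 J); rewrite lerDr in E2; have {}E2 := E2 h0.
have [S _] := bW.
have sh : Num.sqrt h <= 1 by apply: sqrt_leP; lra.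
have rh : r * Num.sqrt h <= r by rewrite -[leRHS]mulr1 ler_wpM2l.
have e2 := S x 0 h (lexx 0) h0 (ltW h1).
have e3 := S (x + J%:R * b) 0 h (lexx 0) h0 (ltW h1).
rewrite -(leaf_shiftN J x 0 h lW) add0r in e3.
rewrite subr0 in e2 e3.
rewrite mulrDl; move: e1 e2 e3 E1 E2 rh.
set X := J%:R * _; set q := r * _; set p := 2 * M%:R * r.
rewrite !ler_norml; clear => *; apply/andP; split; lra.
Qed.

Lemma chunks_close b W (J I : nat) e Y z g : leaf b W ->
  (forall z g, `|W z g (g + J%:R) - Y| <= e) ->
  `|W z g (g + I%:R * J%:R) - I%:R * Y| <= I%:R * e.
Proof.
move=> lW He; have n0 (k : nat) : 0 <= k%:R :> R by exact: ler0n.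
elim: I => [|I IH].
  by rewrite !mul0r addr0 (leaf0 _ _ lW) subrr normr0.
have [add _ _] := lW.
rewrite (add z g (g + I%:R * J%:R)); last first.
  by rewrite lerD2l ler_wpM2r // ler_nat.
  by rewrite lerDl mulr_ge0.
have -> : g + I.+1%:R * J%:R = g + I%:R * J%:R + J%:R by rewrite -natr1; ring.
have := He z (g + I%:R * J%:R); rewrite -natr1 !mulrDl !mul1r => h.
move: IH h; set p := I%:R * e; set q := I%:R * Y.
rewrite !ler_norml; clear => *; apply/andP; split; lra.
Qed.

Lemma line_equidistribution (delta : R) : 0 < delta ->
  exists (eta L0 : R), 0 < eta /\
  forall b W c r, `|b - gold| <= eta -> leaf b W -> leaf_norm_le c r W ->
  exists c', `|c' - c| <= r /\
   forall z g L, L0 <= L -> `|L^-1 * W z g (g + L) - c'| <= delta * r.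
Proof.
move=> d0.
(* Three shares of [delta / 3]: with [th = (delta / 3000) ^+ 2] the horizontal shift takes one, the
   choice of [J] bounds the recurrence time [M] by another, and [12 * J / delta] leaves the third
   for the incomplete last chunk. *)
have d3 : 0 < delta / 3000 by lra.
have th0 := exprn_gt0 2 d3.
have [M [eta [eta0 He]]] := rotation_density th0.
pose J := (Num.truncn (3 * (2 * M%:R + 2) / delta)).+1.
have J0 : 0 < J%:R :> R by rewrite ltr0n.
have HJ : 3 * (2 * M%:R + 2) <= delta * J%:R.
  by rewrite [leRHS]mulrC -ler_pdivrMr //; apply: ltW; rewrite /J truncnS_gt.
exists eta, (12 * J%:R / delta); split => //.
move=> b W c r hb lW bW; have r0 := leaf_norm_ge0 bW.
have rec : recurs b ((delta / 3000) ^+ 2) M by exact: He.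
pose Y := W 0 0 J%:R.
have hY : `|Y - c * J%:R| <= J%:R * r := crossings_bound J 0 lW (fun x => leaf_norm_crossing x bW).
(* The new centre is the mean over [J] crossings of the line through the origin. *)
exists (Y / J%:R); split.
  have -> : Y / J%:R - c = (Y - c * J%:R) / J%:R by field; rewrite gt_eqF.
  by rewrite normrM normfV normr_nat ler_pdivrMr // [r * _]mulrC.
move=> z g L HL.
have L0 : 0 < L by apply: lt_le_trans HL; rewrite !mulr_gt0 ?invr_gt0.
have {}HL : 12 * J%:R <= delta * L by rewrite [leRHS]mulrC -ler_pdivrMr.
pose I := Num.truncn (L / J%:R).
have /andP[I1 I2] := @truncn_itv _ (L / J%:R) (divr_ge0 (ltW L0) (ltW J0)).
rewrite -/I in I1 I2.
rewrite ler_pdivlMr // in I1; rewrite ltr_pdivrMr // -natr1 mulrDl mul1r in I2.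
have ch := chunks_close I z g lW (fun z g => chunk_close J z g lW bW rec).
rewrite sqrtr_sqr (gtr0_norm d3) in ch.
have [add _ _] := lW.
have d1 : 0 <= L - I%:R * J%:R by rewrite subr_ge0.
have d2 : L - I%:R * J%:R <= J%:R by rewrite lerBlDr addrC ltW.
have re := segment_bound z (g + I%:R * J%:R) lW bW (fun x => leaf_norm_crossing x bW) d1.
have E : g + I%:R * J%:R + (L - I%:R * J%:R) = g + L by ring.
rewrite E in re.
have E1 : W z g (g + L) = W z g (g + I%:R * J%:R) + W z (g + I%:R * J%:R) (g + L).
  by apply: add; rewrite ?lerD2l // lerDl mulr_ge0.
have J1 : 1 <= J%:R :> R by rewrite ler1n.
have sq : Num.sqrt (2 * (L - I%:R * J%:R)) <= 2 * J%:R.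
  apply: sqrt_leP; first by rewrite mulr_ge0 // ltW.
  have arith (p j : R) : p <= j -> 1 <= j -> 2 * p <= (2 * j) ^+ 2 by clear => *; nra.
  exact: arith.
have e1 : r * Num.sqrt (2 * (L - I%:R * J%:R)) <= r * (2 * J%:R) by rewrite ler_wpM2l.
have e2 : r * (L - I%:R * J%:R) <= r * J%:R by rewrite ler_wpM2l.
have e3 : I%:R * ((2 * M%:R + 2) * r + J%:R * (1000 * r * (delta / 3000))) <= (2/3) * (delta * r * L).
  have -> : (2 * M%:R + 2) * r + J%:R * (1000 * r * (delta / 3000)) =
     (1/3) * ((3 * (2 * M%:R + 2)) * r + delta * J%:R * r) by field.
  apply: (@le_trans _ _ (I%:R * (1/3 * (delta * J%:R * r + delta * J%:R * r)))).
    by rewrite ler_wpM2l //; have := ler_wpM2r r0 HJ; clear; lra.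
  have -> : I%:R * (1/3 * (delta * J%:R * r + delta * J%:R * r)) = 2/3 * (delta * r * (I%:R * J%:R)) by field.
  have : delta * r * (I%:R * J%:R) <= delta * r * L.
    by rewrite ler_wpM2l // mulr_ge0 // ltW.
  by clear; lra.
have e4 : 4 * (r * J%:R) <= 1/3 * (delta * r * L).
  have -> : 1/3 * (delta * r * L) = r * (delta * L) / 3 by field.
  by have := ler_wpM2l r0 HL; move: (r * (delta * L)); clear => p; lra.
have -> : L^-1 * W z g (g + L) - Y / J%:R = L^-1 * (W z g (g + L) - L / J%:R * Y).
  by field; rewrite !gt_eqF.
rewrite normrM normfV (gtr0_norm L0) -ler_pdivlMl ?invr_gt0 // invrK.
have e5 : `|(L / J%:R - I%:R) * (Y - c * J%:R)| <= r * J%:R.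
  rewrite normrM [r * _]mulrC -[leRHS]mul1r ler_pM // ler_norml.
  have f1 : I%:R <= L / J%:R by rewrite ler_pdivlMr.
  have f2 : L / J%:R <= I%:R + 1 by rewrite ler_pdivrMr // mulrDl mul1r; move: I2; clear; lra.
  by move: f1 f2; clear; lra.
have -> : W z g (g + L) - L / J%:R * Y =
  (W z g (g + I%:R * J%:R) - I%:R * Y) + (W z (g + I%:R * J%:R) (g + L) - c * (L - I%:R * J%:R))
  - (L / J%:R - I%:R) * (Y - c * J%:R).
  by rewrite E1; field; rewrite gt_eqF.
have -> : L * (delta * r) = delta * r * L by ring.
apply: (le_trans (ler_normB _ _)); apply: (le_trans (lerD (ler_normD _ _) (lexx _))).
move: (le_trans ch e3) (le_trans re (lerD e1 e2)) e4 e5.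
rewrite [r * (2 * _)]mulrCA.
set A := `|_|; set B := `|_|; set C := `|_|; set D := r * _; set E' := delta * r * L.
by clear => *; lra.
Qed.

End Equidistribution.

(** * Exponential decay of the oscillation, uniformly in [t] *)

Section Decay.
Variable R : realType.
Implicit Types (W : R -> R -> R -> R) (V : nat -> R -> R -> R -> R -> R) (a b c r u t x h : R).

(** [V k a] stands for the integrals of [phi o F_t^k] along lines of parameter [a]. Splitting off
    the first application of the map lowers [k] and changes the slope, so all admissible slopes are
    treated together. *)
Definition family t V : Prop :=
  (forall k a, slope_ok a -> leaf a (V k a)) /\
  (forall k a, slope_ok a -> pullback t a (V k.+1 a) (V k (slope t a))).

Lemma leaf_norm_leW c r r' W : r <= r' -> leaf_norm_le c r W -> leaf_norm_le c r' W.
Proof.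
move=> rr [H1 H2]; split=> *.
  by apply: (le_trans (H1 _ _ _ _ _ _)) => //; rewrite ler_wpM2r ?sqrtr_ge0.
apply: (le_trans (H2 _ _ _ _ _ _ _)) => //.
by apply: ler_wpM2r; [exact: sqrtr_ge0|lra].
Qed.

Lemma leaf_norm_recenter c c' r W : leaf_norm_le c r W -> `|c' - c| <= r -> leaf_norm_le c' (2 * r) W.
Proof.
move=> bW cc; have r0 := leaf_norm_ge0 bW; have [H1 H2] := bW.
split=> [x h1 h2 h10 h12 h21|x x' h1 h2 *].
  have := H1 x h1 h2 h10 h12 h21.
  have d0 : 0 <= h2 - h1 by lra.
  have := le_sqrt01 d0 _; have d1 : h2 - h1 <= 1 by lra.
  move=> /(_ d1) ds e.
  have -> : W x h1 h2 - c' * (h2 - h1) = (W x h1 h2 - c * (h2 - h1)) - (c' - c) * (h2 - h1) by ring.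
  apply: (le_trans (ler_normB _ _)).
  have -> : 2 * r * Num.sqrt (h2 - h1) = r * Num.sqrt (h2 - h1) + r * Num.sqrt (h2 - h1) by ring.
  apply: lerD => //; rewrite normrM ler_pM // ger0_norm //.
apply: (le_trans (H2 _ _ _ _ _ _ _)) => //.
by apply: ler_wpM2r; [exact: sqrtr_ge0|lra].
Qed.

Lemma slope_ok_iter t a n : time_ok t -> slope_ok a -> slope_ok (iter n (slope t) a).
Proof. by move=> ht ha; elim: n => //= n IH; exact: slope_ok_slope. Qed.

(** One step multiplies the distance from [gold] by [(1 - gold)] over the stretch, which is below
    1/2, and adds at most [t] over the stretch. *)
Lemma slope_gold t a n : time_ok t -> slope_ok a ->
  `|iter n (slope t) a - gold R| <= (1/2) ^+ n + 2 * t.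
Proof.
move=> ht ha; have /andP[t0 _] := ht; have /andP[g1 g2] := gold_bounds R.
have := gold_sqr R; move: (gold R) g1 g2 => g g1 g2 gg.
elim: n => [|n IH].
  by move: ha => /andP[? ?]; rewrite /= expr0 ler_norml; apply/andP; split; lra.
rewrite iterS; have hb := slope_ok_iter n ht ha; move: IH hb.
set b := iter n _ a => IH hb.
have /andP[l1 l2] := stretch_bounds ht hb.
have l0 : 0 < stretch t b by lra.
have -> : slope t b - g = ((1 - g) * (b - g) + g * t) / stretch t b.
  have E : (stretch t b) * (slope t b - g) = (1 - g) * (b - g) + g * t.
    rewrite mulrBr [_ * slope t b]mulrC slope_stretch // /stretch.
    have -> : (1 - g) * (b - g) = b - g - g * b + g ^+ 2 by ring.
    by rewrite gg; ring.
  by rewrite -E mulrC mulKf // gt_eqF.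
rewrite normrM normfV (gtr0_norm l0) ler_pdivrMr //.
apply: (le_trans (ler_normD _ _)); rewrite !normrM (ger0_norm t0) ger0_norm; last by lra.
rewrite [`|g|]ger0_norm; last by lra.
have := normr_ge0 (b - g); move: IH; rewrite exprS.
have : 0 <= (1/2) ^+ n :> R by rewrite exprn_ge0 //; lra.
set p := (1/2) ^+ n; set q := `|b - g| => p0 IH q0.
have e1 : (1 - g) * q <= 2/5 * q by rewrite ler_wpM2r //; lra.
have e2 : g * t <= t by rewrite -[leRHS]mul1r ler_wpM2r //; lra.
have e3 : (1/2 * p + 2 * t) * (51/20) <= (1/2 * p + 2 * t) * stretch t b.
  by rewrite ler_wpM2l //; move: p0 t0; clear; lra.
by move: e1 e2 e3 IH p0 q0 t0; clear; lra.
Qed.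

(** A crude bound, with [u] equal to the full norm; it serves only for numbers of steps that are
    fixed independently of [t]. *)
Lemma leaf_norm_iter t V N k a c r : time_ok t -> family t V -> slope_ok a ->
  leaf_norm_le c r (V k (iter N (slope t) a)) -> leaf_norm_le c (2 ^+ N * r) (V (N + k)%N a).
Proof.
move=> ht [lV pV]; elim: N a => [|N IH] a ha bV; first by rewrite expr0 mul1r.
rewrite iterSr in bV.
have ha' := slope_ok_slope ht ha.
have bV' := IH _ ha' bV.
have r0 := leaf_norm_ge0 bV'.
have := leaf_norm_pullback ht ha (lV _ _ ha') (pV _ _ ha) bV' (fun x => leaf_norm_crossing x bV').
by apply: leaf_norm_leW; rewrite exprS; lra.
Qed.

(** After [N] steps a line piece is replaced by one straight line piece with mean stretch [L]. The
    threshold [t0] depends on [N], [H] and [eps] only, so the lemma applies at every level [k] with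
    the same [t]. *)
Lemma line_iter N (H : nat) (eps : R) : 0 < eps ->
  exists t0 : R, 0 < t0 /\ forall t, time_ok t -> t <= t0 ->
  forall V k a c r, family t V -> slope_ok a ->
    leaf_norm_le c r (V k (iter N (slope t) a)) ->
  forall x h1 h2, 0 <= h1 -> h1 <= h2 -> h2 <= H%:R ->
  exists z g L, 2 ^+ N <= L /\
    `|V (N + k)%N a x h1 h2 - L^-1 * V k (iter N (slope t) a) z g (g + L * (h2 - h1))| <= eps * r.
Proof.
elim: N H eps => [|N IH] H eps e0.
  exists 1; split=> // t ht _ V k a c r fV ha bV x h1 h2 h10 h12 h2H.
  exists x, h1, 1; rewrite expr0; split=> //.
  rewrite invr1 !mul1r [h1 + _]addrC subrK subrr normr0 mulr_ge0 ?(leaf_norm_ge0 bV) //.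
  exact: ltW.
have e20 : 0 < eps / 2 by rewrite divr_gt0.
(* The stretch is at most 3, and the base point, reduced modulo 1, raises the image by less than
   1. *)
have [t1 [t10 Ht1]] := IH (3 * H + 1)%N _ e20.
have H0 : 0 < H%:R + 1 :> R by rewrite ltr_wpDl // ler0n.
have H0' : 0 <= H%:R :> R by rewrite ler0n.
have p0 : 0 < 2 ^+ N :> R by rewrite exprn_gt0.
(* The bound of [pullback_line] for a norm [2 ^+ N * r] becomes at most [eps / 2 * r] once
   [sqrt (H t) <= kap]. *)
pose kap := eps / 2 / (2000 * 2 ^+ N * (H%:R + 1)).
have kap0 : 0 < kap.
  by apply: divr_gt0 e20 _; apply: mulr_gt0 H0; apply: mulr_gt0 p0; lra.
pose t2 := Num.min 1 (kap ^+ 2) / (H%:R + 1).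
have m0 : 0 < Num.min 1 (kap ^+ 2) by rewrite lt_min ltr01 exprn_gt0.
have t20 : 0 < t2 by rewrite divr_gt0.
exists (Num.min t1 t2); split; first by rewrite lt_min t10.
move=> t ht; rewrite le_min => /andP[tt1 tt2] V k a c r fV ha bV x h1 h2 h10 h12 h2H.
have /andP[t0 _] := ht.
have ha' := slope_ok_slope ht ha.
rewrite iterSr in bV *.
have bV' := leaf_norm_iter ht fV ha' bV.
have r0 := leaf_norm_ge0 bV.
have [lV pV] := fV.
have HtM : H%:R * t <= Num.min 1 (kap ^+ 2).
  move: tt2; rewrite ler_pdivlMr // => tt2; apply: le_trans tt2.
  by rewrite mulrC ler_wpM2l // lerDl.
have Htn1 : H%:R * t <= 1 by apply: (le_trans HtM); rewrite ge_min lexx.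
have Htk : Num.sqrt (H%:R * t) <= kap.
  by apply: sqrt_leP; [exact: ltW|apply: (le_trans HtM); rewrite ge_min lexx orbT].
pose z := Num.floor x.
pose x' := x - z%:~R.
have x'0 : 0 <= x' by rewrite subr_ge0; exact: floor_le.
have x'1 : x' < 1 by have := lt_succ_floor x; rewrite /x' /z intrD1; lra.
have -> : V (N.+1 + k)%N a x h1 h2 = V (N + k).+1 a x' h1 h2.
  by rewrite -(leaf_perZ z x' _ _ (lV _ _ ha)) /x' subrK.
have e1 := pullback_line x' ht ha (lV _ _ ha) (lV _ _ ha') (pV _ _ ha) bV' Htn1 h10 h12 h2H.
have /andP[l1 l2] := stretch_bounds ht ha.
have l0 : 0 < stretch t a by lra.
have k1 : 0 <= x' + stretch t a * h1 by rewrite addr_ge0 ?mulr_ge0 // ltW.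
have k2 : x' + stretch t a * h1 <= x' + stretch t a * h2 by rewrite lerD2l ler_pM2l.
have k3 : x' + stretch t a * h2 <= (3 * H + 1)%:R.
  rewrite natrD natrM; have : stretch t a * h2 <= 3 * H%:R by apply: ler_pM => //; [exact: ltW|exact: le_trans h12].
  by move: x'1; clear; lra.
have [y [g [L [HL e2]]]] := Ht1 t ht tt1 V k (slope t a) c r fV ha' bV ((1 - slope t a) * x') _ _ k1 k2 k3.
have L0 : 0 < L by apply: lt_le_trans HL.
exists y, g, (L * stretch t a); split.
  by rewrite exprSr ler_pM //; move: p0 l1; clear; lra.
have -> : g + L * stretch t a * (h2 - h1) = g + L * (x' + stretch t a * h2 - (x' + stretch t a * h1)) by ring.
set A := V k _ _ _ _ in e2 *; set B := V (N + k)%N _ _ _ _ in e1 e2.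
set C := V _ _ _ _ _ in e1 *.
have -> : C - (L * stretch t a)^-1 * A = (C - (stretch t a)^-1 * B) + (stretch t a)^-1 * (B - L^-1 * A).
  by field; rewrite !gt_eqF.
apply: (le_trans (ler_normD _ _)).
have e3 : `|C - (stretch t a)^-1 * B| <= eps / 2 * r.
  apply: (le_trans e1).
  apply: (@le_trans _ _ (H%:R * (2000 * (2 ^+ N * r) * kap))).
    have k0 : 0 <= 2 ^+ N * r by rewrite mulr_ge0 // ltW.
    have k1' : 0 <= 2000 * (2 ^+ N * r) by move: k0; clear; lra.
    exact: (ler_wpM2l H0' (ler_wpM2l k1' Htk)).
  have -> : H%:R * (2000 * (2 ^+ N * r) * kap) = (H%:R / (H%:R + 1)) * (eps / 2 * r).
    by rewrite /kap; field; rewrite !gt_eqF.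
  rewrite -[leRHS]mul1r ler_wpM2r //; first by rewrite mulr_ge0 // ltW.
  by rewrite ler_pdivrMr // mul1r lerDl.
have e4 : `|(stretch t a)^-1 * (B - L^-1 * A)| <= eps / 2 * r.
  rewrite normrM normfV (gtr0_norm l0) -[leRHS]mul1r ler_pM ?invr_ge0 ?(ltW l0) //.
  by rewrite invf_le1 //; move: l1; clear; lra.
by move: e3 e4; clear; lra.
Qed.

(** The contraction argument estimates crossings at many successive levels and needs a common
    threshold for [t]. *)
Lemma line_iter_upto Nmax (eps : R) : 0 < eps ->
  exists t0 : R, 0 < t0 /\ forall t, time_ok t -> t <= t0 ->
  forall N V k a c r, (N <= Nmax)%N -> family t V -> slope_ok a ->
    leaf_norm_le c r (V k (iter N (slope t) a)) ->
  forall x, exists z g L, 2 ^+ N <= L /\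
    `|V (N + k)%N a x 0 1 - L^-1 * V k (iter N (slope t) a) z g (g + L)| <= eps * r.
Proof.
move=> e0; elim: Nmax => [|Nm [t1 [t10 IH]]].
  have [t1 [t10 H1]] := line_iter 0 1 e0; exists t1; split=> // t ht tt N V k a c r.
  rewrite leqn0 => /eqP -> fV ha bV x.
  have [z [g [L]]] := H1 t ht tt V k a c r fV ha bV x 0 1 (lexx 0) ler01 (lexx 1).
  by rewrite subr0 mulr1; exists z, g, L.
have [t2 [t20 H2]] := line_iter Nm.+1 1 e0.
exists (Num.min t1 t2); split; first by rewrite lt_min t10.
move=> t ht; rewrite le_min => /andP[tt1 tt2] N V k a c r.
rewrite leq_eqVlt => /predU1P[-> fV ha bV x|]; last by rewrite ltnS; exact: IH.
have [z [g [L]]] := H2 t ht tt2 V k a c r fV ha bV x 0 1 (lexx 0) ler01 (lexx 1).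
by rewrite subr0 mulr1; exists z, g, L.
Qed.

Lemma half_pow_le (x : R) : 0 < x -> exists n : nat, (1/2) ^+ n <= x.
Proof.
move=> x0; exists (Num.truncn x^-1).+1.
rewrite expr_div_n expr1n div1r -[leRHS]invrK lef_pV2 ?posrE ?invr_gt0 ?exprn_gt0 //.
apply: ltW; apply: (lt_le_trans (truncnS_gt _)).
by rewrite -natrX ler_nat ltnW // ltn_expl.
Qed.

(** From level [N0 + k] on, a complete crossing unfolds at level [k] into a line longer than [L0],
    so its integral is close to [c']. Reaching that level costs [2 ^+ N0]; the next [M] steps, each
    gaining 99/100, undo this cost. *)
Lemma leaf_norm_contraction : exists (N : nat) (t0 : R), (0 < N)%N /\ 0 < t0 /\
  forall t, time_ok t -> t <= t0 -> forall V k r, family t V ->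
  (forall a, slope_ok a -> exists c, leaf_norm_le c r (V k a)) ->
  (forall a, slope_ok a -> exists c, leaf_norm_le c (r / 2) (V (N + k)%N a)).
Proof.
(* Used twice, for straightening and for equidistribution: crossings deviate by at most [r / 400],
   and [r / 4] is the fixed point of [p -> 99/100 * p + r / 400]. *)
have d0 : 0 < 1/800 :> R by lra.
have h0 : 0 <= 1/2 :> R by lra.
have h1 : 1/2 <= 1 :> R by lra.
have [eta [L0 [eta0 Heq]]] := line_equidistribution d0.
have eta20 : 0 < eta / 2 by rewrite divr_gt0.
have [N1 HN1] := half_pow_le eta20.
pose N2 := (Num.truncn L0).+1.
pose N0 := (N1 + N2)%N.
have HN0 : (1/2) ^+ N0 <= eta / 2.
  apply: le_trans HN1; rewrite exprD -[leRHS]mulr1 ler_wpM2l ?exprn_ge0 //.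
  by rewrite exprn_ile1.
have HL0 n : (N0 <= n)%N -> L0 <= 2 ^+ n.
  move=> Hn; apply: ltW; apply: (lt_le_trans (truncnS_gt _)).
  rewrite -natrX ler_nat -/N2; apply: leq_trans (_ : n <= _)%N; last by rewrite ltnW // ltn_expl.
  by apply: leq_trans Hn; rewrite leq_addl.
(* The factor 2 comes from recentring at [c']; together with the fixed part [r / 4] the total is
   [r / 2]. *)
have [M HM] : exists M : nat, (99/100) ^+ M * (2 ^+ N0 * 2) <= 1/4 :> R.
  have p0 : 0 < 2 ^+ N0 * 2 :> R by rewrite mulr_gt0 ?exprn_gt0.
  have q0 : 0 < 1/4 / (2 ^+ N0 * 2) :> R by rewrite divr_gt0 //; lra.
  have [n Hn] := half_pow_le q0.
  exists (n * 100)%N; rewrite -ler_pdivlMr //; apply: le_trans Hn.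
  rewrite mulnC exprM lerXn2r ?nnegrE ?exprn_ge0 //; try lra.
have [t1 [t10 Hline]] := line_iter_upto (N0 + M) d0.
(* By [slope_gold] the final slope is within [eta / 2 + 2 * t] of [gold]. *)
exists (N0 + M)%N, (Num.min t1 (eta / 4)).
split; first by rewrite /N0 /N2 addnS.
split; first by rewrite lt_min t10 divr_gt0.
move=> t ht; rewrite le_min => /andP[tt1 tte] V k r fV Hb a ha.
have [lV pV] := fV.
set b := iter (N0 + M) (slope t) a.
have hb : slope_ok b by exact: slope_ok_iter.
have [c bV] := Hb b hb.
have r0 := leaf_norm_ge0 bV.
have bg : `|b - gold R| <= eta.
  apply: (le_trans (slope_gold _ ht ha)).
  have : (1/2) ^+ (N0 + M) <= (1/2) ^+ N0 :> R.
    by rewrite exprD -[leRHS]mulr1 ler_wpM2l ?exprn_ge0 // exprn_ile1.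
  by move: HN0 tte; clear; lra.
have [c' [cc' Hc']] := Heq b _ c r bg (lV k b hb) bV.
exists c'.
have bV' := leaf_norm_recenter bV cc'.
suff : forall i, (i <= M)%N -> leaf_norm_le c' ((99/100) ^+ i * (2 ^+ N0 * (2 * r)) + r / 4)
   (V (i + (N0 + k))%N (iter (M - i) (slope t) a)).
  move=> /(_ M (leqnn M)); rewrite subnn /=.
  have -> : (M + (N0 + k) = N0 + M + k)%N by rewrite addnCA addnA.
  apply: leaf_norm_leW.
  have := ler_wpM2r r0 HM; move: ((99/100) ^+ M) (2 ^+ N0) => p q; rewrite !mulrA.
  by clear; lra.
elim=> [|i IH] iM.
  rewrite expr0 mul1r subn0 add0n.
  have := leaf_norm_iter (N := N0) (a := iter M (slope t) a) (k := k) ht fV (slope_ok_iter _ ht ha).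
  move=> /(_ c' (2 * r)); rewrite -iterD => /(_ bV'); apply: leaf_norm_leW.
  by rewrite lerDl divr_ge0.
have {}IH := IH (ltnW iM).
have ei : iter (M - i) (slope t) a = slope t (iter (M - i.+1) (slope t) a).
  by rewrite -iterS -subSn.
have ha1 := slope_ok_iter (M - i.+1) ht ha.
have ha2 := slope_ok_iter (M - i) ht ha.
rewrite ei in IH.
have u : forall x, `|V (i + (N0 + k))%N (slope t (iter (M - i.+1) (slope t) a)) x 0 1 - c'| <= r / 400.
  move=> x; rewrite -ei.
  (* For every [i] the crossing unfolds at level [k] into a line of the same slope [b], so one
     centre [c'] serves all [M] steps. *)
  have eb : iter (i + N0) (slope t) (iter (M - i) (slope t) a) = b.
    by rewrite -iterD /b; congr (iter _ _ _); rewrite addnAC subnKC 1?addnC // ltnW.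
  have iN : (i + N0 <= N0 + M)%N by rewrite addnC leq_add2l ltnW.
  have := Hline t ht tt1 (i + N0)%N V k (iter (M - i) (slope t) a) c r iN fV ha2.
  rewrite eb => /(_ bV x)[z [g [L [HL e1]]]].
  have LL : L0 <= L by apply: le_trans HL; apply: HL0; rewrite leq_addl.
  have e2 := Hc' z g L LL.
  rewrite addnA; move: e1 e2.
  set A := V _ _ _ _ _; set B := L^-1 * _ => e1 e2.
  have -> : A - c' = (A - B) + (B - c') by ring.
  apply: (le_trans (ler_normD _ _)); move: e1 e2; clear; lra.
have pb : pullback t (iter (M - i.+1) (slope t) a) (V (i.+1 + (N0 + k))%N (iter (M - i.+1) (slope t) a)) (V (i + (N0 + k))%N (slope t (iter (M - i.+1) (slope t) a))) by exact: pV.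
have := leaf_norm_pullback ht ha1 (lV _ _ (slope_ok_slope ht ha1)) pb IH u.
apply: leaf_norm_leW; rewrite exprS.
set p := (99/100) ^+ i; set q := 2 ^+ N0 * _.
have -> : 99/100 * p * q = 99/100 * (p * q) by ring.
by move: r0; clear; lra.
Qed.

Lemma leaf_norm_decay : exists (t0 C q : R), [/\ 0 < t0, t0 <= 1/20, 0 <= C, 0 < q < 1 &
  forall t, time_ok t -> t <= t0 -> forall V r, family t V -> 0 <= r ->
  (forall a, slope_ok a -> exists c, leaf_norm_le c r (V 0 a)) ->
  forall k a, slope_ok a -> exists c, leaf_norm_le c (C * r * q ^+ k) (V k a)].
Proof.
have [N [t0 [N0 [t00 H]]]] := leaf_norm_contraction.
have N0R : 0 < N%:R :> R by rewrite ltr0n.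
(* Bernoulli's inequality gives [q ^+ N >= 1/2] without extracting a root. *)
pose q : R := 1 - (2 * N%:R)^-1.
have i0 : 0 < (2 * N%:R)^-1 :> R by rewrite invr_gt0 mulr_gt0.
have i1 : (2 * N%:R)^-1 <= 1/2 :> R.
  by rewrite div1r lef_pV2 ?posrE ?mulr_gt0 // ler_pMr // ler1n.
have q0 : 0 < q by rewrite /q; lra.
have q1 : q < 1 by rewrite /q; lra.
have qN : 1/2 <= q ^+ N.
  have bern n : 1 - n%:R * (2 * N%:R)^-1 <= q ^+ n.
    elim: n => [|n IH]; first by rewrite expr0; lra.
    rewrite exprSr -natr1; have n0 : 0 <= n%:R :> R by rewrite ler0n.
    have e : 0 <= n%:R * (2 * N%:R)^-1 * (2 * N%:R)^-1 :> R by exact: (mulr_ge0 (mulr_ge0 n0 (ltW i0)) (ltW i0)).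
    apply: le_trans (ler_wpM2r (ltW q0) IH).
    by rewrite /q; move: e; set y := (2 * _)^-1; clear; lra.
  apply: le_trans (bern N).
  have -> : N%:R * (2 * N%:R)^-1 = 1/2 :> R by field; rewrite gt_eqF.
  by lra.
exists (Num.min t0 (1/20)), (2 ^+ N / q ^+ N), q; split.
- by rewrite lt_min t00; lra.
- by rewrite ge_min lexx orbT.
- by rewrite divr_ge0 ?exprn_ge0 // ltW.
- by rewrite q0.
move=> t ht; rewrite le_min => /andP[tt _] V r fV r0 Hr k a ha.
have HN : forall j (a : R), slope_ok a -> exists c, leaf_norm_le c (r * (1/2) ^+ j) (V (j * N)%N a).
  elim=> [|j IH] a' ha'; first by rewrite expr0 mulr1 mul0n; exact: Hr.
  have := H t ht tt V _ _ fV IH a' ha'; rewrite mulSn.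
  by have -> : r * (1/2) ^+ j / 2 = r * (1/2) ^+ j.+1 by rewrite exprS; field.
(* The first [j] blocks halve the norm; the other [m < N] steps are crude and are absorbed by the
   constant [2 ^+ N / q ^+ N]. *)
pose j := (k %/ N)%N; pose m := (k %% N)%N.
have hk : (k = m + j * N)%N by rewrite {1}(divn_eq k N) addnC.
have [c bV] := HN j _ (slope_ok_iter m ht ha).
exists c; have := leaf_norm_iter ht fV ha bV; rewrite -hk; apply: leaf_norm_leW.
have mN : (m <= N)%N by rewrite ltnW // ltn_pmod.
have e1 : 2 ^+ m <= 2 ^+ N :> R by rewrite ler_eXn2l // ltr1n.
have e2 : (1/2) ^+ j <= q ^+ (j * N) :> R.
  by rewrite mulnC exprM lerXn2r ?nnegrE ?exprn_ge0 // ?ltW //; lra.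
have e3 : q ^+ (j * N) <= q ^+ k / q ^+ N.
  rewrite ler_pdivlMr ?exprn_gt0 // -exprD hk.
  by apply: ler_wiXn2l; [exact: ltW|exact: ltW|rewrite addnC leq_add2l].
have -> : 2 ^+ N / q ^+ N * r * q ^+ k = 2 ^+ N * (r * (q ^+ k / q ^+ N)) by ring.
have h0 : 0 <= 1/2 :> R by lra.
apply: ler_pM; rewrite ?exprn_ge0 // ?mulr_ge0 ?exprn_ge0 //.
by rewrite ler_wpM2l // (le_trans e2).
Qed.

End Decay.

(** * Integrals of bounded measurable functions over intervals *)

Section Integral.
Variable R : realType.
Notation mu := (@lebesgue_measure R).
Implicit Types (a b c k K : R).

(** Being global, this condition survives translations and affine substitutions, and it gives
    integrability on every set of finite measure. *)
Definition bmeas d (T : measurableType d) (f : T -> R) : Prop :=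
  measurable_fun setT f /\ exists K, forall x, `|f x| <= K.

Lemma bmeas_cst d (T : measurableType d) (k : R) : bmeas (fun _ : T => k).
Proof. by split; [exact: measurable_cst|exists `|k|]. Qed.

Lemma bmeasD d (T : measurableType d) (f g : T -> R) :
  bmeas f -> bmeas g -> bmeas (fun x => f x + g x).
Proof.
move=> [mf [K HK]] [mg [L HL]]; split; first exact: measurable_funD.
by exists (K + L) => x; apply: (le_trans (ler_normD _ _)); rewrite lerD.
Qed.

Lemma bmeasB d (T : measurableType d) (f g : T -> R) :
  bmeas f -> bmeas g -> bmeas (fun x => f x - g x).
Proof.
move=> [mf [K HK]] [mg [L HL]]; split; first exact: measurable_funB.
by exists (K + L) => x; apply: (le_trans (ler_normB _ _)); rewrite lerD.
Qed.

Lemma bmeasZ d (T : measurableType d) (k : R) (f : T -> R) :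
  bmeas f -> bmeas (fun x => k * f x).
Proof.
move=> [mf [K HK]]; split; first exact: measurable_funM.
by exists (`|k| * K) => x; rewrite normrM ler_wpM2l.
Qed.

Lemma bmeas_comp d d' (T : measurableType d) (T' : measurableType d') (f : T -> R) (g : T' -> T) :
  bmeas f -> measurable_fun setT g -> bmeas (f \o g).
Proof.
move=> [mf [K HK]] mg; split; first exact: measurableT_comp.
by exists K => x; exact: HK.
Qed.

Lemma bmeas_integrable d (T : measurableType d) (nu : {measure set T -> \bar R}) (A : set T) (f : T -> R) :
  measurable A -> (nu A < +oo)%E -> bmeas f -> nu.-integrable A (EFin \o f).
Proof.
move=> mA A0 [mf [K HK]]; apply: measurable_bounded_integrable => //.
  exact: measurable_funS mf.
exists K; split; first exact: num_real.
by move=> M KM x _; apply: (le_trans (HK x)); exact: ltW.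
Qed.

Lemma bmeas_itv (f : R -> R) a b (b1 b2 : bool) : bmeas f ->
  mu.-integrable [set` Interval (BSide b1 a) (BSide b2 b)] (EFin \o f).
Proof.
move=> bf; apply: bmeas_integrable => //.
rewrite /= lebesgue_measure_itv /=; case: ifP => // _.
by rewrite -EFinB ltry.
Qed.

Implicit Types (f g : R -> R).

Definition itg f a b : R := \int[mu]_(x in `[a, b]) f x.

Lemma itg_oo f a b : bmeas f -> itg f a b = \int[mu]_(x in `]a, b[) f x.
Proof.
move=> bf; rewrite /itg -Rintegral_itv_obnd_cbnd; last exact: bmeas_itv.
by rewrite -Rintegral_itv_bndo_bndc //; exact: bmeas_itv.
Qed.

(** The end points must be left out: the formula for the image of a segment holds for heights below
    1 only. *)
Lemma itg_eq f g a b : bmeas f -> bmeas g ->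
  (forall x, a < x < b -> f x = g x) -> itg f a b = itg g a b.
Proof.
move=> bf bg fg; rewrite !itg_oo //; apply: eq_Rintegral => x.
by rewrite inE /= in_itv /=; exact: fg.
Qed.

Lemma itg_add f a b c : bmeas f -> a <= b -> b <= c -> itg f a c = itg f a b + itg f b c.
Proof.
move=> bf ab bc; have := @Rintegral_itvB R f (BLeft a) (BRight c) b (bmeas_itv _ _ _ _ bf).
rewrite !bnd_simp => /(_ ab bc); rewrite Rintegral_itv_obnd_cbnd; last exact: bmeas_itv.
by rewrite /itg => <-; ring.
Qed.

Lemma itg_cst k a b : a <= b -> itg (fun=> k) a b = k * (b - a).
Proof.
move=> ab; rewrite /itg Rintegral_cst //= lebesgue_measure_itv /= lte_fin.
case: ltP => ab'; first by rewrite -EFinB.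
have -> : b = a by apply: le_anti; rewrite ab ab'.
by rewrite subrr /= mulr0.
Qed.

Lemma itgD f g a b : bmeas f -> bmeas g ->
  itg (fun x => f x + g x) a b = itg f a b + itg g a b.
Proof. by move=> bf bg; rewrite /itg RintegralD //; exact: bmeas_itv. Qed.

Lemma itgB f g a b : bmeas f -> bmeas g ->
  itg (fun x => f x - g x) a b = itg f a b - itg g a b.
Proof. by move=> bf bg; rewrite /itg RintegralB //; exact: bmeas_itv. Qed.

Lemma itgZ k f a b : bmeas f -> itg (fun x => k * f x) a b = k * itg f a b.
Proof. by move=> bf; rewrite /itg RintegralZl //; exact: bmeas_itv. Qed.

Lemma itg_le f g a b : bmeas f -> bmeas g ->
  (forall x, a < x < b -> f x <= g x) -> itg f a b <= itg g a b.
Proof.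
move=> bf bg fg; rewrite !itg_oo //; apply: le_Rintegral => //; exact: bmeas_itv.
Qed.

Lemma itg_bound f a b k K : a <= b -> bmeas f ->
  (forall x, a < x < b -> `|f x - k| <= K) -> `|itg f a b - k * (b - a)| <= K * (b - a).
Proof.
move=> ab bf H.
have bk := @bmeas_cst _ (measurableTypeR R) (k - K).
have bk' := @bmeas_cst _ (measurableTypeR R) (k + K).
have H1 : itg f a b <= itg (fun=> k + K) a b.
  by apply: itg_le => // x /H; rewrite ler_norml; lra.
have H2 : itg (fun=> k - K) a b <= itg f a b.
  by apply: itg_le => // x /H; rewrite ler_norml; lra.
by move: H1 H2; rewrite !itg_cst // ler_norml => H1 H2; apply/andP; split; lra.
Qed.

Definition affine (l c x : R) : R := l * x + c.

Lemma measurable_affine l c : measurable_fun [set: measurableTypeR R]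
  (affine l c : measurableTypeR R -> measurableTypeR R).
Proof.
by apply: measurable_funD => //; apply: measurable_funM => //; exact: measurable_cst.
Qed.

Section Affine.
Variables (l c : R).
Hypothesis l0 : 0 < l.

Let ln : {nonneg R} := NngNum (ltW l0).
Let push : {measure set (measurableTypeR R) -> \bar R} :=
  measure_function_pushforward__canonical__measure_function_Measure mu (measurable_affine l c).

Lemma lebesgue_affine (A : set (measurableTypeR R)) : measurable A ->
  mu A = mscale ln push A.
Proof.
apply: lebesgue_measure_unique => /= _ [[a b]] _ <-.
rewrite /mscale /push /= /pushforward.
rewrite [X in (_ * _ X)%E](_ : _ = `](a - c) / l, (b - c) / l]%classic); last first.
  apply/seteqP; split=> x; rewrite /= !in_itv /= /affine ltr_pdivrMr // ler_pdivlMr //.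
    by move=> /andP[? ?]; apply/andP; split; lra.
  by move=> /andP[? ?]; apply/andP; split; lra.
rewrite !lebesgue_measure_itv /= !lte_fin ltr_pM2r ?invr_gt0 // ltrD2r.
case: ifP => _; last by rewrite mule0.
rewrite -!EFinB -EFinM; congr (_%:E); field.
by rewrite gt_eqF.
Qed.

Lemma ge0_itg_affine f (a b : R) : bmeas f -> (forall x, 0 <= f x) ->
  itg f (l * a + c) (l * b + c) = l * itg (fun x => f (l * x + c)) a b.
Proof.
move=> bf f0; have [mf _] := bf.
rewrite /itg /Rintegral.
have -> : (\int[mu]_(x in `[(l * a + c)%R, (l * b + c)%R]) (f x)%:E =
  \int[mscale ln push]_(x in `[(l * a + c)%R, (l * b + c)%R]) (f x)%:E)%E.
  apply: eq_measure_integral => A mA _; exact: lebesgue_affine.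
have mfD : measurable_fun `[l * a + c, l * b + c]%classic (EFin \o f).
  by apply/measurable_EFinP; exact: measurable_funS mf.
rewrite ge0_integral_mscale //=; last by move=> x _; rewrite lee_fin.
rewrite ge0_integral_pushforward //=; last by move=> x _; rewrite lee_fin.
rewrite [X in integral _ X _](_ : _ = `[a, b]%classic); last first.
  by apply/seteqP; split=> x; rewrite /= !in_itv /= /affine !lerD2r !ler_pM2l.
rewrite fineM //.
apply: integrable_fin_num => //; apply: bmeas_itv.
  exact: (bmeas_comp (g := affine l c) bf (measurable_affine l c)).
exact: measurable_affine.
Qed.

Lemma itg_affine f (a b : R) : a <= b -> bmeas f ->
  itg f (l * a + c) (l * b + c) = l * itg (fun x => f (l * x + c)) a b.
Proof.
move=> ab bf; have [mf [K HK]] := bf.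
have bK := @bmeas_cst _ (measurableTypeR R) K.
have b1 : bmeas (fun x : R => f x + K) by exact: bmeasD.
have b2 : bmeas (fun x : R => f (l * x + c)).
  exact: (bmeas_comp (g := affine l c) bf (measurable_affine l c)).
(* Adding the bound [K] reduces to nonnegative functions; the constant contributes equally to both
   sides. *)
have := ge0_itg_affine a b b1; rewrite itgD // itgD // !itg_cst //; last first.
  by rewrite lerD2r ler_pM2l.
move=> H; have : forall x : R, 0 <= f x + K.
  by move=> x; have := HK x; rewrite ler_norml => /andP[? _]; lra.
by move=> /H; lra.
Qed.

End Affine.

Lemma itg_shift f c a b : a <= b -> bmeas f ->
  itg f (a + c) (b + c) = itg (fun x => f (x + c)) a b.
Proof.
move=> ab bf; have := @itg_affine 1 c ltr01 f a b ab bf.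
rewrite !mul1r => ->; congr itg; apply/funext => x; by rewrite mul1r.
Qed.

Lemma itg_period f c : bmeas f -> (forall x, f (x + 1) = f x) ->
  itg f c (c + 1) = itg f 0 1.
Proof.
move=> bf per.
have perN (n : nat) x : f (x + n%:R) = f x.
  by elim: n x => [|n IH] x; rewrite ?addr0 // -natr1 addrA per IH.
have perZ (z : int) x : f (x + z%:~R) = f x.
  case: z => n; first exact: perN.
  by rewrite NegzE mulrNz -(perN n.+1) subrK.
have [d [d0 d1 ->]] : exists d : R, [/\ 0 <= d, d <= 1 & c = d + (Num.floor c)%:~R].
  exists (c - (Num.floor c)%:~R).
  have := floor_le c; have := lt_succ_floor c; rewrite intrD1 subrK.
  by split; lra.
have -> : itg f (d + (Num.floor c)%:~R) (d + (Num.floor c)%:~R + 1) = itg f d (d + 1).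
  rewrite addrAC itg_shift //; last by lra.
  by congr itg; apply/funext => x; rewrite perZ.
rewrite (@itg_add f d 1 (d + 1)) //; try lra.
rewrite -[X in itg f X (d + 1)]add0r itg_shift //.
have -> : (fun x => f (x + 1)) = f by apply/funext => x; rewrite per.
by rewrite addrC -itg_add.
Qed.

End Integral.

(** * Periodic extension of the observables *)

Section Torus.
Variable R : realType.
Notation mu := (@lebesgue_measure R).

Lemma frac_bounds (x : R) : 0 <= frac x < 1.
Proof.
rewrite /frac; have := floor_le x; have := lt_succ_floor x; rewrite intrD1.
by move=> *; apply/andP; split; lra.
Qed.

Lemma frac_id (x : R) : 0 <= x < 1 -> frac x = x.
Proof.
move=> h; rewrite /frac (_ : Num.floor x = 0) ?subr0 //.
by apply/eqP; rewrite floor_eq add0r.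
Qed.

Lemma frac_addZ (x : R) (z : int) : frac (x + z%:~R) = frac x.
Proof.
by rewrite /frac floorDrz ?intr_int // intrKfloor intrD; ring.
Qed.

Lemma fracE (x : R) : exists z : int, frac x = x + z%:~R.
Proof. by exists (- Num.floor x); rewrite /frac mulrNz. Qed.

Lemma measurable_frac : measurable_fun [set: measurableTypeR R]
  (@frac R : measurableTypeR R -> measurableTypeR R).
Proof.
apply: measurable_funB => //.
apply: nondecreasing_measurable => // x y xy.
by rewrite ler_int le_floor.
Qed.

Lemma C0M_ball (phi : R * R -> R) z e : C0M phi -> closedM z -> 0 < e ->
  exists2 d : R, 0 < d & forall z', closedM z' -> `|z.1 - z'.1| < d -> `|z.2 - z'.2| < d ->
    `|phi z - phi z'| < e.
Proof.
move=> /subspace_continuousP C zM e0.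
have /cvgrPdist_lt /(_ e e0) := C z zM.
rewrite near_withinE => /nbhs_ballP [d /= d0 H].
exists d => // z' z'M h1 h2; exact: (H z').
Qed.

Lemma C0M_bounded (phi : R * R -> R) : C0M phi ->
  exists2 K : R, 0 <= K & forall z, closedM z -> `|phi z| <= K.
Proof.
move=> C; have := continuous_compact C.
have cM : compact (@closedM R) by apply: compact_setX; exact: segment_compact.
move=> /(_ cM) /compact_bounded [M [_ HM]].
exists (`|M| + 1); first by rewrite addr_ge0.
move=> z zM; apply: (HM (`|M| + 1)); last by exists z.
by rewrite ltr_pwDr // ler_norm.
Qed.

Lemma measurable_discrete2 d (T : measurableType d) (k1 k2 : T -> nat) (F : nat -> nat -> R) :
  (forall i, measurable [set x | k1 x = i]) -> (forall i, measurable [set x | k2 x = i]) ->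
  measurable_fun setT (fun x => F (k1 x) (k2 x)).
Proof.
move=> m1 m2 _ B mB; rewrite setTI.
rewrite (_ : _ @^-1` _ = \bigcup_i \bigcup_j ([set x | k1 x = i] `&` [set x | k2 x = j] `&` [set _ | B (F i j)])).
  apply: bigcupT_measurable => i; apply: bigcupT_measurable => j.
  apply: measurableI; first exact: measurableI.
  have [h|h] := pselect (B (F i j)).
    by rewrite (_ : [set _ | _] = setT) //; apply/seteqP; split.
  by rewrite (_ : [set _ | _] = set0) //; apply/seteqP; split.
apply/seteqP; split=> x /=.
  by move=> h; exists (k1 x) => //; exists (k2 x).
by move=> [i _ [j _ [[<- <-]]]].
Qed.

(** The values of [phi] at the lower left corners of a grid of mesh [1 / n.+1] give step functions
    that converge pointwise to [periodize phi]; its measurability follows. *)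
Definition grid (n : nat) (x : R) : nat := Num.truncn (n.+1%:R * frac x).

Lemma measurable_grid n i : measurable ([set x | grid n x = i] : set (measurableTypeR R)).
Proof.
have m : measurable_fun [set: measurableTypeR R] ((fun x => n.+1%:R * frac x) : measurableTypeR R -> measurableTypeR R).
  by apply: measurable_funM => //; exact: measurable_frac.
have := m measurableT `[i%:R, i.+1%:R[%classic (measurable_itv _).
rewrite setTI; congr measurable; apply/seteqP; split=> x /=; rewrite in_itv /=.
  by rewrite -truncn_eq ?mulr_ge0 //; [move=> /eqP|have /andP[] := frac_bounds x].
by move=> <-; rewrite -truncn_eq // mulr_ge0 //; have /andP[] := frac_bounds x.
Qed.

Lemma grid_close n x : 0 <= frac x - (grid n x)%:R / n.+1%:R < n.+1%:R^-1.
Proof.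
have /andP[f0 _] := frac_bounds x.
have n0 : 0 < n.+1%:R :> R by rewrite ltr0n.
have : 0 <= n.+1%:R * frac x by rewrite mulr_ge0.
move=> /truncn_itv; rewrite -/(grid n x) -natr1 => /andP[h1 h2].
rewrite subr_ge0 ler_pdivrMr // mulrC h1 /= ltrBlDr -[X in X + _]mul1r -mulrDl ltr_pdivlMr //.
by move: h2; clear; lra.
Qed.

(** Outside the closed square [phi] is arbitrary and perhaps not measurable; only its values on
    [[0, 1)^2] enter here. *)
Definition periodize (phi : R * R -> R) (z : R * R) : R := phi (frac z.1, frac z.2).

Lemma closedM_frac x y : closedM (frac x : R, frac y : R).
Proof.
have /andP[x0 x1] := frac_bounds x; have /andP[y0 y1] := frac_bounds y.
by split; rewrite /= in_itv /= ?x0 ?y0 /= ltW.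
Qed.

Lemma measurable_periodize phi : C0M phi ->
  measurable_fun [set: plane R] (periodize phi : plane R -> measurableTypeR R).
Proof.
move=> C.
pose h (n : nat) (z : plane R) : R :=
  phi ((grid n z.1)%:R / n.+1%:R, (grid n z.2)%:R / n.+1%:R).
apply: (@measurable_fun_cvg _ _ _ _ h).
  move=> n; apply: (@measurable_discrete2 _ _ (fun z : plane R => grid n z.1) (fun z : plane R => grid n z.2)
     (fun i j => phi (i%:R / n.+1%:R, j%:R / n.+1%:R))) => i.
    have := @measurable_fst _ _ (measurableTypeR R) (measurableTypeR R) measurableT _ (measurable_grid n i).
    by rewrite setTI.
  have := @measurable_snd _ _ (measurableTypeR R) (measurableTypeR R) measurableT _ (measurable_grid n i).
  by rewrite setTI.
move=> z _; apply/cvgrPdist_lt => e e0.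
have [d d0 H] := C0M_ball C (closedM_frac z.1 z.2) e0.
near=> n.
have nd : n.+1%:R^-1 < d.
  near: n; exact: near_infty_natSinv_lt (PosNum d0).
have /andP[a1 a2] := grid_close n z.1; have /andP[b1 b2] := grid_close n z.2.
have /andP[x0 x1] := frac_bounds z.1; have /andP[y0 y1] := frac_bounds z.2.
have g0 x : 0 <= (grid n x)%:R / n.+1%:R :> R by rewrite divr_ge0.
have gz1 := g0 z.1; have gz2 := g0 z.2.
apply: H => /=; last 2 first.
- by rewrite ger0_norm // (lt_trans a2).
- by rewrite ger0_norm // (lt_trans b2).
split; rewrite /= in_itv /= ?gz1 ?gz2 /=.
  by rewrite (le_trans _ (ltW x1)) // -subr_ge0.
by rewrite (le_trans _ (ltW y1)) // -subr_ge0.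
Unshelve. all: by end_near.
Qed.

Lemma bmeas_periodize phi : C0M phi -> bmeas (periodize phi : plane R -> R).
Proof.
move=> C; split; first exact: measurable_periodize.
have [K _ HK] := C0M_bounded C; exists K => z; apply: HK; exact: closedM_frac.
Qed.

Definition fracs (z : R * R) : R * R := (frac z.1, frac z.2).

Lemma measurable_fracs : measurable_fun [set: plane R] (fracs : plane R -> plane R).
Proof.
by apply: measurable_fun_pair; apply: (measurableT_comp measurable_frac).
Qed.

Lemma measurable_FA t : measurable_fun [set: plane R] (FA t : plane R -> plane R).
Proof.
apply: measurable_fun_pair; apply: (measurableT_comp measurable_frac).
  by apply: measurable_funD.
apply: measurable_funD => //.
by apply: measurable_funM.
Qed.

(** The reduction by [fracs] comes first because the formula of [FA t] is not periodic in the second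
    variable: [(2 - t) * y] changes by [2 - t] when [y] grows by 1. *)
Definition observable phi t (k : nat) (z : R * R) : R :=
  periodize phi (iter k (FA t) (fracs z)).

Lemma bmeas_observable phi t k : C0M phi -> bmeas (observable phi t k : plane R -> R).
Proof.
move=> C; apply: (bmeas_comp (f := periodize phi : plane R -> R) (g := fun z : plane R => iter k (FA t) (fracs z))).
  exact: bmeas_periodize.
elim: k => [|k IH]; first exact: measurable_fracs.
exact: (measurableT_comp (measurable_FA t) IH).
Qed.

Lemma observable_addZ phi t k x y (i j : int) :
  observable phi t k (x + i%:~R, y + j%:~R) = observable phi t k (x, y).
Proof. by rewrite /observable /fracs /= !frac_addZ. Qed.

Lemma frac_frac (x : R) : frac (frac x) = frac x.
Proof. by rewrite frac_id ?frac_bounds. Qed.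

Lemma fracs_FA t z : fracs (FA t z) = FA t z.
Proof. by rewrite /fracs /FA /= !frac_frac. Qed.

Lemma observableS phi t k x y : 0 <= y < 1 ->
  observable phi t k.+1 (x, y) = observable phi t k (x + y, x + (2 - t) * y).
Proof.
move=> hy; rewrite /observable iterSr; congr periodize; congr (iter k _ _).
rewrite /FA /fracs /= (frac_id hy).
have [z ->] := fracE x.
by rewrite -(frac_addZ (x + y) z) -(frac_addZ (x + (2 - t) * y) z); congr (frac _, frac _); ring.
Qed.

Lemma bmeas_line (f : plane R -> R) (p q r s : R) : bmeas f ->
  bmeas (fun x : measurableTypeR R => f (p * x + q, r * x + s)).
Proof.
move=> bf; apply: (bmeas_comp (f := f) (g := fun x : measurableTypeR R => (p * x + q, r * x + s) : plane R)) => //.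
apply: measurable_fun_pair; first exact: (measurable_affine p q).
exact: (measurable_affine r s).
Qed.

Definition leafint phi t (k : nat) (a x h1 h2 : R) : R :=
  itg (fun s => observable phi t k (x + a * s, s)) h1 h2.

Lemma bmeas_leaf phi t k a x : C0M phi ->
  bmeas (fun s : measurableTypeR R => observable phi t k (x + a * s, s)).
Proof.
move=> C; have := bmeas_line a x 1 0 (bmeas_observable t k C).
by under eq_fun do rewrite mul1r addr0 addrC.
Qed.
End Torus.

(** * The line integrals of the observables and their initial bound *)

Section LeafInt.
Variable R : realType.
Notation mu := (@lebesgue_measure R).
Implicit Types (phi : R * R -> R).

Lemma itg_gt (f : R -> R) a b : b < a -> itg f a b = 0.
Proof. by move=> ab; rewrite /itg set_itv_ge ?Rintegral_set0 // bnd_simp -ltNge. Qed.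

Lemma leaf_leafint phi t k a : C0M phi -> leaf a (leafint phi t k a).
Proof.
move=> C; split.
- by move=> x h1 h2 h3 h12 h23; apply: itg_add => //; exact: bmeas_leaf.
- move=> x h1 h2; congr itg; apply/funext => s.
  have := observable_addZ phi t k (x + a * s) s 1 0; rewrite addr0 => <-.
  by congr observable; congr pair; ring.
move=> x h1 h2.
(* For [h2 < h1] both integrals run over the empty set. *)
have [h12|h21] := leP h1 h2; last by rewrite /leafint !itg_gt ?ltrD2r.
rewrite /leafint itg_shift //; last exact: bmeas_leaf.
congr itg; apply/funext => s.
have := observable_addZ phi t k (x + a + a * s) s 0 1; rewrite addr0 => <-.
by congr observable; congr pair; ring.
Qed.

Lemma pullback_leafint phi t k a : C0M phi -> time_ok t -> slope_ok a ->
  pullback t a (leafint phi t k.+1 a) (leafint phi t k (slope t a)).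
Proof.
move=> C ht ha x h1 h2 h10 h12 h21.
have /andP[l1 l2] := stretch_bounds ht ha.
have l0 : 0 < stretch t a by lra.
have sl := slope_stretch ht ha.
rewrite /leafint ![x + stretch t a * _]addrC itg_affine //; last exact: bmeas_leaf.
rewrite mulKf ?gt_eqF //.
have E s : (1 - slope t a) * x + slope t a * (stretch t a * s + x) = x + a * s + s.
  have -> : (1 - slope t a) * x + slope t a * (stretch t a * s + x) = x + slope t a * stretch t a * s by ring.
  by rewrite sl; ring.
under [in RHS]eq_fun do rewrite E.
apply: itg_eq => [||s /andP[s0 s1]].
- exact: bmeas_leaf.
- have := bmeas_line (a + 1) x (stretch t a) x (bmeas_observable t k C).
  congr bmeas; apply/funext => s; congr observable; congr pair; ring.
rewrite observableS; last by apply/andP; split; lra.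
by congr observable; congr pair; rewrite /stretch; ring.
Qed.

Lemma family_leafint phi t : C0M phi -> time_ok t -> family t (leafint phi t).
Proof.
by move=> C ht; split=> k a ha; [exact: leaf_leafint|exact: pullback_leafint].
Qed.

(** The mean value theorem asks only for continuity at the ends, so [x] and [x'] may lie on the
    boundary; [y] is interior, where [phi] is differentiable. *)
Lemma C1M_lipschitz phi : C1M phi -> exists2 L : R, 0 <= L &
  forall x x' y, 0 <= x -> x <= x' -> x' <= 1 -> 0 < y < 1 ->
    `|phi (x, y) - phi (x', y)| <= L * (x' - x).
Proof.
move=> [C D [h Ch Dh] _].
have [L L0 HL] := C0M_bounded Ch.
exists L => // x x' y x0 xx' x1 /andP[y0 y1].
have der : forall s : R, s \in `]x, x'[ -> is_derive s 1 (fun s => phi (s, y)) ('D_((1, 0) : R * R) phi (s, y)).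
  move=> s; rewrite in_itv /= => /andP[s0 s1].
  have sM : openM (s, y) by split; rewrite /= in_itv /=; apply/andP; split; lra.
  have dv : derivable phi (s, y) ((1, 0) : R * R) by exact: diff_derivable (D _ sM).
  have E : (fun e : R => e^-1 *: (((fun s => phi (s, y)) \o shift s) (e *: (1 : R)) - phi (s, y))) =
     (fun e : R => e^-1 *: ((phi \o shift (s, y)) (e *: ((1, 0) : R * R)) - phi (s, y))).
    apply/funext => e /=; congr (_ *: (phi _ - _)).
    by congr pair => /=; rewrite ?scaler0 ?add0r.
  split; first by rewrite /derivable E.
  by rewrite /derive E.
have cts : {within `[x, x'], continuous (fun s => phi (s, y))}.
  apply/subspace_continuousP => s; rewrite /= in_itv /= => /andP[s0 s1].
  apply/cvgrPdist_lt => e e0.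
  have sM : closedM (s, y) by split; rewrite /= in_itv /=; apply/andP; split; lra.
  have [d d0 H] := C0M_ball C sM e0.
  rewrite near_withinE; apply/nbhs_ballP; exists d => // s' /= bs; rewrite in_itv /= => /andP[u0 u1].
  apply: H => //=; last by rewrite subrr normr0.
  by split; rewrite /= in_itv /=; apply/andP; split; lra.
have := xx'; rewrite le_eqVlt => /predU1P[->|xlt]; first by rewrite !subrr normr0 mulr0.
have [c] := @MVT R (fun s => phi (s, y)) (fun s => 'D_((1, 0) : R * R) phi (s, y)) x x' xlt der cts.
rewrite in_itv /= => /andP[c0 c1] E.
have cM : openM (c, y) by split; rewrite /= in_itv /=; apply/andP; split; lra.
have cM' : closedM (c, y) by split; rewrite /= in_itv /=; apply/andP; split; lra.
rewrite distrC E normrM [`|x' - x|]ger0_norm ?subr_ge0 // ler_wpM2r ?subr_ge0 //.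
by rewrite (Dh (c, y) (mem_set cM)); exact: HL.
Qed.

Lemma bmeas_frac (p q : R) : bmeas (fun s : measurableTypeR R => frac (p * s + q)).
Proof.
split.
  have := measurableT_comp (@measurable_frac R) (measurable_affine p q).
  exact.
by exists 1 => s; have /andP[f0 f1] := frac_bounds (p * s + q); rewrite ger0_norm // ltW.
Qed.

(* [d + frac y - frac (y + d)] counts the integers in the interval from [y] to
   [y + d]. *)
Lemma frac_diff_itg (d p q h1 h2 : R) : 0 < p -> 0 <= d -> h1 <= h2 ->
  itg (fun s => frac (p * s + q)) h1 h2 - itg (fun s => frac (p * s + (q + d))) h1 h2 <= d / p.
Proof.
move=> p0 d0 h12.
have dp : 0 <= d / p by rewrite divr_ge0 // ltW.
have bf := bmeas_frac p q.
have -> : itg (fun s => frac (p * s + (q + d))) h1 h2 =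
   itg (fun s => frac (p * s + q)) (h1 + d / p) (h2 + d / p).
  rewrite itg_shift //; congr itg; apply/funext => s; congr frac.
  by field; rewrite gt_eqF.
have A1 : itg (fun s => frac (p * s + q)) h1 (h2 + d / p) =
  itg (fun s => frac (p * s + q)) h1 (h1 + d / p) + itg (fun s => frac (p * s + q)) (h1 + d / p) (h2 + d / p).
  by apply: itg_add => //; rewrite ?lerDl // lerD2r.
have A2 : itg (fun s => frac (p * s + q)) h1 (h2 + d / p) =
  itg (fun s => frac (p * s + q)) h1 h2 + itg (fun s => frac (p * s + q)) h2 (h2 + d / p).
  by apply: itg_add => //; rewrite lerDl.
have B h : 0 <= itg (fun s => frac (p * s + q)) h (h + d / p) <= d / p.
  have hd : h <= h + d / p by rewrite lerDl.
  have b0 := @bmeas_cst R _ (measurableTypeR R) 0.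
  have b1 := @bmeas_cst R _ (measurableTypeR R) 1.
  have := itg_le b0 bf (a := h) (b := h + d / p); have := itg_le bf b1 (a := h) (b := h + d / p).
  rewrite !itg_cst // mul0r mul1r addrAC subrr add0r => H1 H2; apply/andP; split.
    by apply: H2 => s _; have /andP[] := frac_bounds (p * s + q).
  by apply: H1 => s _; have /andP[_ /ltW] := frac_bounds (p * s + q).
have /andP[b1 b2] := B h1; have /andP[b3 b4] := B h2.
by move: A1 A2 b1 b2 b3 b4; clear; lra.
Qed.

(** If no integer is passed between [x] and [x + d], the Lipschitz bound applies; otherwise the
    trivial bound [2 * K] does. *)
Lemma periodize_diff phi K L x d y : C0M phi -> (forall z, closedM z -> `|phi z| <= K) ->
  (forall x x' y, 0 <= x -> x <= x' -> x' <= 1 -> 0 < y < 1 ->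
    `|phi (x, y) - phi (x', y)| <= L * (x' - x)) -> 0 <= L -> 0 <= d -> 0 < y < 1 ->
  `|periodize phi (x, y) - periodize phi (x + d, y)| <=
    L * d + 2 * K * (d + frac x - frac (x + d)).
Proof.
move=> C HK HL L0 d0 hy; have /andP[y0 y1] := hy.
have K0 : 0 <= K by apply: le_trans (HK _ (closedM_frac 0 0)).
have yy : frac y = y by rewrite frac_id // y1 ltW.
rewrite /periodize /= yy.
have /andP[a0 a1] := frac_bounds x; have /andP[b0 b1] := frac_bounds (x + d).
have mE : d + frac x - frac (x + d) = (Num.floor (x + d) - Num.floor x)%:~R.
  by rewrite /frac intrB; ring.
have : (0 : int) <= Num.floor (x + d) - Num.floor x by rewrite subr_ge0 le_floor // lerDl.
rewrite le_eqVlt => /predU1P[m0|].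
  rewrite -m0 in mE.
  rewrite mE mulr0 addr0; have {}mE : d = frac (x + d) - frac x by move: mE; rewrite mulr0z; lra.
  by rewrite [in leRHS]mE; apply: HL => //; lra.
rewrite gtz0_ge1 -(ler_int R) => m1.
have h1 := HK _ (closedM_frac x y); have h2 := HK _ (closedM_frac (x + d) y).
rewrite yy in h1 h2.
apply: (le_trans (ler_normB _ _)).
have : 2 * K <= 2 * K * (d + frac x - frac (x + d)).
  by rewrite mE -[leLHS]mulr1 ler_wpM2l // mulr_ge0.
have : 0 <= L * d by rewrite mulr_ge0.
by move: h1 h2; clear; lra.
Qed.

(** The periodized [phi] jumps at integer abscissae, but since [a >= 3/5] a shift by [d] meets these
    jumps only on a set of heights of measure [O(d)]. *)
Lemma initial_bound phi : C1M phi -> exists2 r : R, 0 <= r &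
  forall t a, slope_ok a -> leaf_norm_le 0 r (leafint phi t 0 a).
Proof.
move=> C1; have [C _ _ _] := C1.
have [K K0 HK] := C0M_bounded C.
have [L L0 HL] := C1M_lipschitz C1.
exists (K + L); first by rewrite addr_ge0.
move=> t a /andP[a0 a1].
have bl x := @bmeas_leaf R phi t 0 a x C.
have ob z : observable phi t 0 z = periodize phi z by rewrite /observable /periodize /= !frac_frac.
have obK z : `|observable phi t 0 z| <= K by rewrite ob; apply: HK; exact: closedM_frac.
have S x h1 h2 : h1 <= h2 -> `|leafint phi t 0 a x h1 h2| <= K * (h2 - h1).
  move=> h12; have := @itg_bound R (fun s => observable phi t 0 (x + a * s, s)) h1 h2 0 K h12 (bl x).
  by rewrite mul0r subr0; apply => s _; rewrite subr0.
split=> [x h1 h2 h10 h12 h21|].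
  rewrite mul0r subr0; apply: (le_trans (S _ _ _ h12)).
  by apply: ler_pM; rewrite ?subr_ge0 ?lerDl //; apply: le_sqrt01; lra.
move=> x x' h1 h2 h10 h12 h21.
wlog xx : x x' / x <= x'.
  move=> wl; have [xx|/ltW xx] := leP x x'; first exact: wl.
  by rewrite distrC [X in Num.sqrt X]distrC; exact: wl.
have [d d0 ->] : exists2 d : R, 0 <= d & x' = x + d by exists (x' - x); [rewrite subr_ge0|ring].
have -> : `|x - (x + d)| = d by rewrite opprD addrA subrr add0r normrN ger0_norm.
have r0 : 0 <= 1000 * (K + L) by move: K0 L0; clear; lra.
have [d1|/ltW d1] := leP d 1; last first.
  have s1 : 1 <= Num.sqrt d by rewrite -[X in X <= _]sqrtr1 ler_wsqrtr.
  have e1 := S x h1 h2 h12; have e2 := S (x + d) h1 h2 h12.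
  have e3 : K * (h2 - h1) <= K by rewrite -[leRHS]mulr1 ler_wpM2l //; lra.
  apply: (le_trans (ler_normB _ _)); apply: (@le_trans _ _ (1000 * (K + L) * 1)).
    by move: e1 e2 e3 K0 L0; clear; lra.
  by rewrite (ler_wpM2l r0 s1).
(* The integers passed contribute [2 * K * (d + d / a)], and [d / a <= 2 * d]. *)
have main : `|leafint phi t 0 a x h1 h2 - leafint phi t 0 a (x + d) h1 h2| <= (L + 6 * K) * d.
  pose g s := L * d + 2 * K * (d + frac (a * s + x) - frac (a * s + (x + d))).
  have bg : bmeas (g : measurableTypeR R -> R).
    apply: bmeasD; first exact: bmeas_cst.
    by apply/bmeasZ/bmeasB; [apply: bmeasD; [exact: bmeas_cst|exact: bmeas_frac]|exact: bmeas_frac].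
  have pt s : h1 < s < h2 -> `|observable phi t 0 (x + a * s, s) - observable phi t 0 (x + d + a * s, s)| <= g s.
    move=> /andP[s0 s1]; rewrite !ob.
    have -> : x + d + a * s = (x + a * s) + d by ring.
    have -> : g s = L * d + 2 * K * (d + frac (x + a * s) - frac (x + a * s + d)).
      by rewrite /g [a * s + x]addrC [a * s + (x + d)]addrC [x + d + _]addrAC.
    by apply: periodize_diff => //; apply/andP; split; lra.
  have Ig : itg g h1 h2 <= (L + 6 * K) * d.
    have bc k := @bmeas_cst R _ (measurableTypeR R) k.
    have b1 := bmeas_frac a x; have b2 := bmeas_frac a (x + d).
    have b3 := bmeasD (bc d) b1; have b4 := bmeasB b3 b2.
    have b5 := bmeasZ (2 * K) b4.
    rewrite /g (itgD _ _ (bc (L * d)) b5) (itgZ (2 * K) _ _ b4) (itgB _ _ b3 b2) (itgD _ _ (bc d) b1).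
    have ap : 0 < a by lra.
    have := frac_diff_itg x ap d0 h12.
    set I1 := itg (fun s => frac _) _ _; set I2 := itg (fun s => frac _) _ _ => Id.
    rewrite !itg_cst //.
    have dh : d * (h2 - h1) <= d by rewrite -[leRHS]mulr1 ler_wpM2l //; lra.
    have da : d / a <= 2 * d by rewrite ler_pdivrMr //; nra.
    have Id3 : 2 * K * (d * (h2 - h1) + I1 - I2) <= 2 * K * (3 * d).
      by rewrite ler_wpM2l ?mulr_ge0 //; move: Id dh da; clear; lra.
    have Ld : L * d * (h2 - h1) <= L * d by rewrite -mulrA ler_wpM2l.
    by move: Id3 Ld; clear; lra.
  have e1 : leafint phi t 0 a x h1 h2 - leafint phi t 0 a (x + d) h1 h2 <= itg g h1 h2.
    rewrite /leafint -(itgB _ _ (bl x) (bl (x + d))).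
    apply: (itg_le (bmeasB (bl x) (bl (x + d))) bg).
    by move=> s /pt; rewrite ler_norml => /andP[].
  have e2 : leafint phi t 0 a (x + d) h1 h2 - leafint phi t 0 a x h1 h2 <= itg g h1 h2.
    rewrite /leafint -(itgB _ _ (bl (x + d)) (bl x)).
    apply: (itg_le (bmeasB (bl (x + d)) (bl x)) bg).
    by move=> s /pt; rewrite distrC ler_norml => /andP[].
  by rewrite ler_norml; apply/andP; split; move: e1 e2 Ig; clear; lra.
apply: (le_trans main); apply: (@le_trans _ _ (1000 * (K + L) * d)).
  by rewrite ler_wpM2r //; move: K0 L0; clear; lra.
by rewrite (ler_wpM2l r0 (le_sqrt01 d0 d1)).
Qed.

End LeafInt.

(** * Iterated integrals on the square *)

Section Fubini.
Variable R : realType.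
Notation mu := (@lebesgue_measure R).

Lemma measurable_openM : measurable (@openM R : set (plane R)).
Proof. by apply: measurableX; exact: measurable_itv. Qed.

Lemma openM_lty : (m2 R (@openM R) < +oo)%E.
Proof.
rewrite /m2 /= product_measure1E //= ?lebesgue_measure_itv /=; try exact: measurable_itv.
by rewrite lte_fin ltr01 -EFinB -EFinM ltry.
Qed.

Section IteratedIntegral.
Variable f : plane R -> R.
Hypothesis bf : bmeas f.

Let g : plane R -> \bar R := (EFin \o f) \_ (@openM R).

Lemma integrable_restrict : (mu \x mu)%E.-integrable setT g.
Proof.
apply: (integrable_mkcond (EFin \o f) measurable_openM).1.
apply: bmeas_integrable => //; [exact: measurable_openM|exact: openM_lty].
Qed.

Lemma openME x y : (((x, y) : R * R) \in @openM R) = (x \in `]0, 1[) && (y \in `]0, 1[).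
Proof.
apply/idP/andP => [|[hx hy]]; first by rewrite inE => -[].
by rewrite inE; split.
Qed.

Lemma bmeas_fst y : bmeas (fun x : measurableTypeR R => f (x, y)).
Proof.
have := bmeas_line 1 0 0 y bf; congr bmeas; apply/funext => x.
by rewrite mul1r addr0 mul0r add0r.
Qed.

Lemma bmeas_snd x : bmeas (fun y : measurableTypeR R => f (x, y)).
Proof.
have := bmeas_line 0 x 1 0 bf; congr bmeas; apply/funext => y.
by rewrite mul1r addr0 mul0r add0r.
Qed.

Lemma itg_EFin (h : R -> R) : bmeas (h : measurableTypeR R -> R) ->
  (\int[mu]_(x in `]0%R, 1%R[) (h x)%:E)%E = (itg h 0 1)%:E.
Proof.
move=> bh; rewrite itg_oo // /Rintegral fineK //.
by apply: integrable_fin_num => //; exact: bmeas_itv.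
Qed.

Lemma integM_xy : integM (m2 R) f = itg (fun x => itg (fun y => f (x, y)) 0 1) 0 1.
Proof.
rewrite /integM /Rintegral integral_mkcond -/g -(integral12_prod_meas1 integrable_restrict).
have E : fubini_F mu g = (EFin \o (fun x => itg (fun y => f (x, y)) 0 1)) \_ `]0, 1[.
  apply/funext => x; rewrite /patch /fubini_F.
  case: ifPn => hx.
    rewrite /= -itg_EFin; last exact: bmeas_snd.
    rewrite [RHS]integral_mkcond; apply: eq_integral => y _.
    by rewrite /g /patch openME; move: hx; rewrite !mem_setE => -> .
  apply: integral0_eq => y _; rewrite /g /patch openME.
  by move: hx; rewrite mem_setE => /negbTE ->.
(* Adding the end points to []0, 1[] requires a measurable inner integral, which Fubini's theorem
   provides. *)
have := measurable_fubini_F integrable_restrict; rewrite E -integral_mkcond => m.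
have m1 : measurable_fun (`]0, 1[%classic : set (measurableTypeR R)) (fun x => itg (fun y => f (x, y)) 0 1).
  apply/measurable_EFinP; apply/(measurable_restrictT _ _).2 => //; exact: m.
have /measurable_EFinP m3 := (measurable_fun_itv_bndo_bndcP _ _ _).1 m1.
have /measurable_EFinP m2' := m1.
by rewrite (integral_itv_bndo_bndc m2') (integral_itv_obnd_cbnd m3).
Qed.

Lemma integM_yx : integM (m2 R) f = itg (fun y => itg (fun x => f (x, y)) 0 1) 0 1.
Proof.
rewrite /integM /Rintegral integral_mkcond -/g -(integral21_prod_meas1 integrable_restrict).
have E : fubini_G mu g = (EFin \o (fun y => itg (fun x => f (x, y)) 0 1)) \_ `]0, 1[.
  apply/funext => y; rewrite /patch /fubini_G.
  case: ifPn => hy.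
    rewrite /= -itg_EFin; last exact: bmeas_fst.
    rewrite [RHS]integral_mkcond; apply: eq_integral => x _.
    by rewrite /g /patch openME; move: hy; rewrite !mem_setE => ->; rewrite andbT.
  apply: integral0_eq => x _; rewrite /g /patch openME.
  by move: hy; rewrite mem_setE => /negbTE ->; rewrite andbF.
have := measurable_fubini_G integrable_restrict; rewrite E -integral_mkcond => m.
have m1 : measurable_fun (`]0, 1[%classic : set (measurableTypeR R)) (fun y => itg (fun x => f (x, y)) 0 1).
  apply/measurable_EFinP; apply/(measurable_restrictT _ _).2 => //; exact: m.
have /measurable_EFinP m3 := (measurable_fun_itv_bndo_bndcP _ _ _).1 m1.
have /measurable_EFinP m2' := m1.
by rewrite (integral_itv_bndo_bndc m2') (integral_itv_obnd_cbnd m3).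
Qed.

End IteratedIntegral.
End Fubini.

(** * Termwise limits of geometrically dominated series *)

Section Tannery.
Variable R : realType.

Lemma geometric_tail (a : nat -> R) (B q l : R) : 0 <= B -> 0 < q < 1 ->
  (forall k, `|a k| <= B * q ^+ k) -> series a n @[n --> \oo] --> l ->
  forall N, `|l - series a N| <= B / (1 - q) * q ^+ N.
Proof.
move=> B0 /andP[q0 q1] Ha al N.
have q1' : 0 < 1 - q by lra.
have part n : `|series a (n + N)%N - series a N| <= B / (1 - q) * (q ^+ N - q ^+ (n + N)).
  elim: n => [|n IH]; first by rewrite add0n !subrr normr0 mulr0.
  have -> : series a (n.+1 + N)%N = series a (n + N)%N + a (n + N)%N.
    by rewrite addSn /series /= big_nat_recr.
  rewrite addrAC; apply: (le_trans (ler_normD _ _)).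
  apply: (le_trans (lerD IH (Ha _))).
  have -> : B * q ^+ (n + N) = B / (1 - q) * (q ^+ (n + N) - q ^+ (n.+1 + N)).
    rewrite addSn exprS; field; lra.
  by rewrite -mulrDr addrA subrK.
have cv : `|series a (n + N)%N - series a N| @[n --> \oo] --> `|l - series a N|.
  apply: cvg_norm; apply: cvgB; last exact: cvg_cst.
  by rewrite (cvg_shiftn N (series a)).
apply: (@cvgr_to_le _ _ _ _ _ _ _ cv); apply: nearW => n /=.
apply: (le_trans (part n)); rewrite ler_wpM2l ?divr_ge0 ?(ltW q1') //.
by rewrite lerBlDr lerDl exprn_ge0 // ltW.
Qed.

(** The bound passes to the limits [b k], so the tails are small uniformly in [t], and only finitely
    many terms remain. *)
Lemma tannery (a : R -> nat -> R) (b : nat -> R) (s : R -> R) (t0 B q : R) :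
  0 < t0 -> 0 <= B -> 0 < q < 1 ->
  (forall t, 0 < t <= t0 -> forall k, `|a t k| <= B * q ^+ k) ->
  (forall t, 0 < t <= t0 -> series (a t) n @[n --> \oo] --> s t) ->
  (forall k, a t k @[t --> 0^'+] --> b k) ->
  cvgn (series b) /\ s t @[t --> 0^'+] --> limn (series b).
Proof.
move=> t00 B0 hq Ha Hs Hb; have /andP[q0 q1] := hq.
have small : \forall t \near 0^'+, 0 < t <= t0.
  near=> t; apply/andP; split; first by near: t; exact: nbhs_right_gt.
  by near: t; exact: nbhs_right_le.
have Hbk k : `|b k| <= B * q ^+ k.
  have cv : `|a t k| @[t --> 0^'+] --> `|b k| by apply: cvg_norm; exact: Hb.
  apply: (@cvgr_to_le _ _ _ _ _ _ _ cv).
  by apply: filterS small => t ht; exact: Ha.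
have cb : cvgn (series b).
  apply: normed_cvg; apply: (@series_le_cvg _ _ (geometric B q)) => // [n|n|].
  - exact: normr_ge0.
  - by rewrite /= mulr_ge0 ?exprn_ge0 // ltW.
  by apply: is_cvg_geometric_series; rewrite ger0_norm // ltW.
split=> //; apply/cvgrPdist_lt => e e0.
have C0 : 0 <= B / (1 - q) by rewrite divr_ge0 // subr_ge0 ltW.
have e3 : 0 < e / 3 by rewrite divr_gt0.
have [N HN] : exists N, B / (1 - q) * q ^+ N < e / 3.
  have nq : `|q| < 1 by rewrite ger0_norm // ltW.
  have := cvg_geometric (B / (1 - q)) nq.
  move=> /cvgrPdist_lt /(_ _ e3) [N _ HN]; exists N.
  have := HN N (leqnn N); rewrite /= sub0r normrN; exact: le_lt_trans (ler_norm _).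
have cN : series (a t) N @[t --> 0^'+] --> series b N.
  elim: N {HN} => [|n IH].
    by rewrite /series /=; under eq_fun do rewrite big_geq //; rewrite big_geq //; exact: cvg_cst.
  rewrite /series /=; under eq_fun do rewrite big_nat_recr //=; rewrite big_nat_recr //=.
  by apply: cvgD.
have near1 : \forall t \near 0^'+, `|series b N - series (a t) N| < e / 3.
  by move/cvgrPdist_lt: cN; apply.
apply: filterS2 small near1 => t ht h1.
have h2 := geometric_tail B0 hq (Ha t ht) (Hs t ht) N.
have h3 := geometric_tail B0 hq Hbk cb N.
have -> : limn (series b) - s t = (limn (series b) - series b N) + (series b N - series (a t) N) - (s t - series (a t) N) by ring.
apply: (le_lt_trans (ler_normB _ _)).
apply: (le_lt_trans (lerD (ler_normD _ _) (lexx _))).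
move: h1 h2 h3 HN; clear; lra.
Unshelve. all: by end_near.
Qed.

End Tannery.

(** * Means over the circles [y = x + w] *)

Section Strip.
Variable R : realType.
Notation mu := (@lebesgue_measure R).
Variable phi : R * R -> R.
Hypothesis C : C0M phi.

(** The function [h_k] of the overview. *)
Definition strip t k (w : R) : R := itg (fun u => observable phi t k (u, u + w)) 0 1.

Lemma bmeas_strip_line t k w : bmeas (fun u : measurableTypeR R => observable phi t k (u, u + w)).
Proof.
have := bmeas_line 1 0 1 w (bmeas_observable t k C); congr bmeas; apply/funext => u.
by rewrite mul1r addr0.
Qed.

Lemma observable_add1 t k x y : observable phi t k (x + 1, y + 1) = observable phi t k (x, y).
Proof. exact: (observable_addZ phi t k x y 1 1). Qed.

(** The circle meets height 0 at [- w]; periodicity moves the heights from [[w, w + 1]] to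
    [[0, 1]]. *)
Lemma strip_leaf t k w : strip t k w = leafint phi t k 1 (- w) 0 1.
Proof.
rewrite /leafint -(@itg_period R _ w) //; last 2 first.
- exact: bmeas_leaf.
- by move=> s; rewrite mulrDr mulr1 addrA observable_add1.
rewrite -[X in itg _ X _]add0r [w + 1]addrC itg_shift //; last exact: bmeas_leaf.
congr itg; apply/funext => u; congr observable; congr pair; ring.
Qed.

Lemma fracs_openM (z : R * R) : openM z -> fracs z = z.
Proof.
case: z => x y [/=]; rewrite !in_itv /= => /andP[x0 x1] /andP[y0 y1].
by rewrite /fracs /= !frac_id // ?(ltW x0) ?(ltW y0).
Qed.

Lemma observable_fracs t k (z : R * R) : fracs z = z -> observable phi t k z = phi (iter k (FA t) z).
Proof.
move=> zM; rewrite /observable zM -[periodize phi _]/(phi (fracs _)).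
by case: k => [|k]; [rewrite /= zM|rewrite iterS fracs_FA].
Qed.

Lemma observable_openM t k (z : R * R) : openM z -> observable phi t k z = phi (iter k (FA t) z).
Proof. by move=> zM; rewrite observable_fracs // fracs_openM. Qed.

Lemma integM_iter t k : integM (m2 R) (phi \o iter k (FA t)) = itg (strip t k) 0 1.
Proof.
have bo := bmeas_observable t k C.
have -> : integM (m2 R) (phi \o iter k (FA t)) = integM (m2 R) (observable phi t k).
  by apply: eq_Rintegral => z; rewrite inE => zM; exact: (esym (observable_openM t k zM)).
rewrite (integM_xy bo).
have -> : (fun x => itg (fun y => observable phi t k (x, y)) 0 1) =
   (fun x => itg (fun w => observable phi t k (x, x + w)) 0 1).
  apply/funext => x.
  rewrite -(@itg_period R _ x); last 2 first.
  - exact: (bmeas_snd bo).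
  - by move=> y; have := observable_addZ phi t k x y 0 1; rewrite addr0.
  rewrite -[X in itg _ X _]add0r [x + 1]addrC itg_shift //; last exact: (bmeas_snd bo).
  by congr itg; apply/funext => w; rewrite addrC.
pose g (z : plane R) := observable phi t k (z.1, z.1 + z.2).
have bg : bmeas g.
  apply: (bmeas_comp (f := observable phi t k : plane R -> R) (g := fun z : plane R => (z.1, z.1 + z.2) : plane R)) => //.
  by apply: measurable_fun_pair => //; apply: measurable_funD.
by rewrite -[LHS](integM_xy bg) (integM_yx bg).
Qed.

(** The points of height [y] are mapped to [(x + y, x + y + (1 - t) * y)], which runs once around
    the circle with [w = (1 - t) * y]. *)
Lemma integM_iterS t k : integM (m2 R) (phi \o iter k.+1 (FA t)) =
  itg (fun y => strip t k ((1 - t) * y)) 0 1.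
Proof.
pose g (z : plane R) := observable phi t k (z.1 + z.2, z.1 + (2 - t) * z.2).
have bg : bmeas g.
  apply: (bmeas_comp (f := observable phi t k : plane R -> R) (g := fun z : plane R => (z.1 + z.2, z.1 + (2 - t) * z.2) : plane R)).
    exact: bmeas_observable.
  apply: measurable_fun_pair; apply: measurable_funD => //.
  by apply: measurable_funM.
have -> : integM (m2 R) (phi \o iter k.+1 (FA t)) = integM (m2 R) g.
  apply: eq_Rintegral => -[x y]; rewrite inE => zM; rewrite -[LHS]/(phi (iter k.+1 (FA t) (x, y))).
  rewrite -(observable_openM t k.+1 zM).
  rewrite observableS //; case: zM => _ /=; rewrite in_itv /= => /andP[y0 y1].
  by rewrite (ltW y0).
rewrite (integM_yx bg).
have -> // : (fun y => itg (fun x => g (x, y)) 0 1) = (fun y => strip t k ((1 - t) * y)).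
apply/funext => y; rewrite /strip -[RHS](@itg_period R _ y); last 2 first.
- exact: bmeas_strip_line.
- by move=> u; rewrite addrAC observable_add1.
rewrite -[X in itg _ X (y + 1)]add0r [y + 1]addrC itg_shift //; last exact: bmeas_strip_line.
have -> // : (fun x => g (x, y)) = (fun x => observable phi t k (x + y, x + y + (1 - t) * y)).
by apply/funext => u; rewrite /g /=; congr observable; congr pair; ring.
Qed.

Section Bound.
Variables (t c rho : R) (k : nat).
Hypothesis ht : 0 < t <= 1/20.
Hypothesis bV : leaf_norm_le c rho (leafint phi t k 1).

Lemma strip_close w : `|strip t k w - c| <= rho.
Proof. by rewrite strip_leaf; exact: leaf_norm_crossing. Qed.

Lemma strip_holder w w' : `|strip t k w - strip t k w'| <= 1000 * rho * Num.sqrt `|w - w'|.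
Proof.
rewrite !strip_leaf; have [_ H] := bV.
have -> : `|w - w'| = `|- w - (- w')| by rewrite -opprB normrN opprK addrC.
exact: H.
Qed.

Lemma bmeas_strip : bmeas (strip t k : measurableTypeR R -> R).
Proof.
have r0 := leaf_norm_ge0 bV.
split; last first.
  exists (`|c| + rho) => w; rewrite -[strip t k w](subrK c) addrC.
  by apply: (le_trans (ler_normD _ _)); rewrite lerD2l strip_close.
(* Hoelder continuity in [w] is the horizontal half of the leaf norm. *)
apply: continuous_measurable_fun => w; apply/cvgrPdist_lt => e e0.
have k0 : 0 < 1000 * rho + 1 by move: r0; lra.
apply/nbhs_ballP; exists ((e / (1000 * rho + 1)) ^+ 2) => /=.
  by rewrite exprn_gt0 ?divr_gt0 ?k0.
move=> w' bw; apply: (le_lt_trans (strip_holder w w')).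
have s1 : Num.sqrt `|w - w'| <= e / (1000 * rho + 1).
  by apply: sqrt_leP; [rewrite divr_ge0 ?(ltW k0) ?(ltW e0)|exact: ltW].
apply: (@le_lt_trans _ _ (1000 * rho * (e / (1000 * rho + 1)))).
  by apply: (ler_wpM2l _ s1); move: r0; lra.
by rewrite mulrA ltr_pdivrMr ?k0 // mulrC (ltr_pM2l e0) ltrDl.
Qed.

Definition mean_iter t k : R := integM (m2 R) (phi \o iter k (FA t)).

Lemma strip_period : strip t k 1 = strip t k 0.
Proof.
rewrite !strip_leaf oppr0; have [_ per _] := leaf_leafint t k 1 C.
by rewrite -(per (-1)) addrC subrr.
Qed.

Lemma strip_balance : (1 - t) * (mean_iter t k.+1 - mean_iter t k) =
  t * mean_iter t k - itg (strip t k) (1 - t) 1.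
Proof.
have /andP[t0 t1] := ht.
have l0 : 0 < 1 - t by lra.
have l1 : 1 - t <= 1 by lra.
have H := itg_affine 0 l0 ler01 bmeas_strip; rewrite mulr0 mulr1 !addr0 in H.
have E : (fun x => strip t k ((1 - t) * x + 0)) = (fun x => strip t k ((1 - t) * x)).
  by apply/funext => x; rewrite addr0.
rewrite E in H.
have S := itg_add bmeas_strip (ltW l0) l1.
rewrite /mean_iter integM_iterS integM_iter.
have arith (p q r s : R) : r = (1 - t) * p -> q = r + s -> (1 - t) * (p - q) = t * q - s.
  by move=> -> ->; ring.
exact: (arith _ _ _ _ H S).
Qed.

Lemma mean_close : `|mean_iter t k - c| <= rho.
Proof.
have := itg_bound (k := c) (K := rho) ler01 bmeas_strip (fun x _ => strip_close x).
by rewrite subr0 !mulr1 /mean_iter integM_iter.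
Qed.

Lemma quotientE : (mean_iter t k.+1 - mean_iter t k) / t =
  (1 - t)^-1 * (mean_iter t k - itg (strip t k) (1 - t) 1 / t).
Proof.
have /andP[t0 t1] := ht.
have l0 : 1 - t != 0 by rewrite gt_eqF //; lra.
have t0' : t != 0 by rewrite gt_eqF.
apply: (mulfI l0); rewrite mulVKf // mulrA strip_balance.
by field.
Qed.

(** Both means lie within [rho] of [c], which cancels; [2 / (1 - t) <= 3]. *)
Lemma quotient_bound : `|(mean_iter t k.+1 - mean_iter t k) / t| <= 3 * rho.
Proof.
have /andP[t0 t1] := ht.
have r0 := leaf_norm_ge0 bV.
have l0 : 0 < 1 - t by lra.
rewrite quotientE normrM normfV (gtr0_norm l0) ler_pdivrMl //.
have t1' : 1 - t <= 1 by lra.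
have e1 := itg_bound (k := c) (K := rho) t1' bmeas_strip (fun x _ => strip_close x).
have e2 : `|itg (strip t k) (1 - t) 1 / t - c| <= rho.
  have -> : itg (strip t k) (1 - t) 1 / t - c = (itg (strip t k) (1 - t) 1 - c * t) / t.
    by field; rewrite gt_eqF.
  rewrite normrM normfV (gtr0_norm t0) ler_pdivrMr //.
  by move: e1; have -> : 1 - (1 - t) = t by ring.
have e3 := mean_close.
have -> : mean_iter t k - itg (strip t k) (1 - t) 1 / t =
  (mean_iter t k - c) - (itg (strip t k) (1 - t) 1 / t - c) by ring.
apply: (le_trans (ler_normB _ _)).
have : rho * (19/20) <= rho * (1 - t) by rewrite ler_wpM2l //; lra.
by move: e2 e3 r0; lra.
Qed.

(** Near [w = 1] the circles approach [w = 1], which is the diagonal [w = 0] again. *)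
Lemma strip_end : `|itg (strip t k) (1 - t) 1 / t - strip t k 0| <= 1000 * rho * Num.sqrt t.
Proof.
have /andP[t0 t1] := ht.
have r0 := leaf_norm_ge0 bV.
have t1' : 1 - t <= 1 by lra.
have H x : 1 - t < x < 1 -> `|strip t k x - strip t k 0| <= 1000 * rho * Num.sqrt t.
  move=> /andP[x0 x1]; rewrite -strip_period; apply: (le_trans (strip_holder _ _)).
  apply: ler_wpM2l; first by move: r0; lra.
  by rewrite ler_wsqrtr // distrC ger0_norm; lra.
have := itg_bound t1' bmeas_strip H; have -> : 1 - (1 - t) = t by ring.
have -> : itg (strip t k) (1 - t) 1 / t - strip t k 0 = (itg (strip t k) (1 - t) 1 - strip t k 0 * t) / t.
  by field; rewrite gt_eqF.
by rewrite normrM normfV (gtr0_norm t0) ler_pdivrMr.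
Qed.

End Bound.

End Strip.

(** * The diagonal integral as [t] tends to 0 *)

Section Diagonal.
Variable R : realType.
Notation mu := (@lebesgue_measure R).

Lemma frac_cvg (v : nat -> R) (x : R) : (forall z : int, x <> z%:~R) ->
  v n @[n --> \oo] --> x -> frac (v n) @[n --> \oo] --> frac x.
Proof.
move=> xz vx.
have f1 : (Num.floor x)%:~R < x.
  by rewrite lt_neqAle floor_le andbT eq_sym; apply/eqP; exact: xz.
have f2 : x < (Num.floor x)%:~R + 1 by have := lt_succ_floor x; rewrite intrD1.
have E : \forall n \near \oo, v n - (Num.floor x)%:~R = frac (v n).
  near=> n; rewrite /frac; congr (_ - _%:~R); apply/esym/eqP.
  rewrite floor_eq intrD; apply/andP; split.
    by apply/ltW; near: n; exact: (cvgr_gt _ vx).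
  by near: n; exact: (cvgr_lt _ vx).
apply: cvg_trans (near_eq_cvg E) _.
by apply: cvgB => //; exact: cvg_cst.
Unshelve. all: by end_near.
Qed.

(** Written as the equations that must fail for the orbit to avoid integer coordinates. *)
Definition rational_points : set R := [set u | exists p (z : int), (0 < p)%N /\ p%:R * u = z%:~R].

Lemma countable_rational_points : countable rational_points.
Proof.
apply: (@sub_countable _ _ _ [set (pz.2%:~R / pz.1%:R : R) | pz in [set: nat * int]]).
  apply: subset_card_le => u [p [z [p0 E]]]; exists (p, z) => //=.
  by rewrite -E mulrC mulKf // pnatr_eq0 -lt0n.
apply: (@sub_countable _ _ _ [set: nat * int]); first exact: card_image_le.
exact: countableP.
Qed.

(* At [t = 0] both coordinates of the orbit of [(u, u)] are fractional parts of
   positive multiples of [u], so for irrational [u] it avoids the discontinuities. *)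
Lemma orbit_cvg (u : R) (tn : nat -> R) (k : nat) : 0 < u < 1 -> ~ rational_points u ->
  tn n @[n --> \oo] --> 0 ->
  exists p q : nat, [/\ (0 < p)%N, (0 < q)%N,
    iter k (FA 0) (u, u) = (frac (p%:R * u), frac (q%:R * u)),
    (iter k (FA (tn n)) (u, u)).1 @[n --> \oo] --> frac (p%:R * u) &
    (iter k (FA (tn n)) (u, u)).2 @[n --> \oo] --> frac (q%:R * u)].
Proof.
move=> /andP[u0 u1] irr tn0.
have nz (p : nat) : (0 < p)%N -> forall z : int, p%:R * u <> z%:~R.
  by move=> p0 z E; apply: irr; exists p, z.
elim: k => [|k [p [q [p0 q0 E c1 c2]]]].
  exists 1%N, 1%N; split => //; rewrite ?mul1r ?frac_id ?u1 ?(ltW u0) //=; exact: cvg_cst.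
have [z1 Z1] := fracE (p%:R * u); have [z2 Z2] := fracE (q%:R * u).
(* The coefficients evolve under the matrix of the cat map and stay positive. *)
exists (p + q)%N, (p + 2 * q)%N; split; rewrite ?addn_gt0 ?p0 //.
- rewrite iterS E /FA /= subr0 Z1 Z2; congr pair.
    rewrite -(frac_addZ ((p + q)%:R * u) (z1 + z2)); congr frac.
    by rewrite natrD intrD; ring.
  rewrite -(frac_addZ ((p + 2 * q)%:R * u) (z1 + 2 * z2)); congr frac.
  by rewrite natrD natrM intrD intrM; ring.
- under eq_fun do rewrite iterS /=.
  rewrite -(frac_addZ _ (z1 + z2)); apply: frac_cvg.
    move=> z H; apply: (nz (p + q)%N _ (z - (z1 + z2))); first by rewrite addn_gt0 p0.
    by rewrite intrB -H addrK.
  have -> : (p + q)%:R * u + (z1 + z2)%:~R = frac (p%:R * u) + frac (q%:R * u).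
    by rewrite natrD intrD Z1 Z2; ring.
  exact: cvgD.
under eq_fun do rewrite iterS /=.
rewrite -(frac_addZ _ (z1 + 2 * z2)); apply: frac_cvg.
  move=> z H; apply: (nz (p + 2 * q)%N _ (z - (z1 + 2 * z2))); first by rewrite addn_gt0 p0.
  by rewrite intrB -H addrK.
have -> : (p + 2 * q)%:R * u + (z1 + 2 * z2)%:~R = frac (p%:R * u) + (2 - 0) * frac (q%:R * u).
  by rewrite natrD natrM intrD intrM Z1 Z2; ring.
apply: cvgD => //; apply: cvgM => //.
by apply: cvgB => //; exact: cvg_cst.
Qed.

Lemma itg_dominated (fn : nat -> R -> R) (f : R -> R) (K : R) (N : set R) :
  countable N -> (forall n, bmeas (fn n : measurableTypeR R -> R)) ->
  bmeas (f : measurableTypeR R -> R) -> (forall n x, `|fn n x| <= K) ->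
  (forall x, 0 < x < 1 -> ~ N x -> fn n x @[n --> \oo] --> f x) ->
  itg (fn n) 0 1 @[n --> \oo] --> itg f 0 1.
Proof.
move=> cN bfn bf HK cv.
have mN : measurable (N : set (measurableTypeR R)) by exact: countable_measurable.
have N0 : mu N = 0%E by exact: countable_lebesgue_measure0.
have mD : measurable (`]0, 1[%classic : set (measurableTypeR R)) by exact: measurable_itv.
have mfn n : measurable_fun (`]0, 1[%classic : set (measurableTypeR R)) (EFin \o fn n).
  by apply/measurable_EFinP; apply: measurable_funS (bfn n).1.
have mf : measurable_fun (`]0, 1[%classic : set (measurableTypeR R)) (EFin \o f).
  by apply/measurable_EFinP; apply: measurable_funS bf.1.
have iK : mu.-integrable `]0, 1[ (EFin \o (fun=> K : R)).
  by apply: bmeas_itv; exact: bmeas_cst.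
have [|| _ _ H] := @dominated_convergence _ _ R mu _ mD (fun n => EFin \o fn n) (EFin \o f) _ mfn mf _ iK.
- exists N; split => // x /= H; apply: contrapT => nN; apply: H.
  rewrite in_itv /= => x01.
  by apply: cvg_EFin; [exact: nearW|exact: cv].
- by apply: aeW => x n _ /=; rewrite lee_fin HK.
have fin : (\int[mu]_(x in `]0%R, 1%R[) (f x)%:E \is a fin_num)%E.
  by apply: integrable_fin_num => //; exact: bmeas_itv.
rewrite itg_oo // /Rintegral.
have -> : (fun n => itg (fn n) 0 1) = (fun n => fine (\int[mu]_(x in `]0%R, 1%R[) (fn n x)%:E)%E).
  by apply/funext => n; rewrite (itg_oo _ _ (bfn n)).
by apply: fine_cvg; rewrite fineK.
Qed.

Lemma strip_diagonal (phi : R * R -> R) k : C0M phi ->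
  strip phi t k 0 @[t --> 0^'+] -->
    \int[mu]_(s in `[0, 1]) (phi \o iter k (FA 0)) (s, s).
Proof.
move=> C.
pose F t (u : R) := observable phi t k (u, u + 0).
have bF t : bmeas (F t : measurableTypeR R -> R) by exact: bmeas_strip_line.
have FE t u : 0 <= u < 1 -> F t u = phi (iter k (FA t) (u, u)).
  by move=> hu; rewrite /F addr0 observable_fracs // /fracs /= !frac_id.
(* At [s = 1] the integrands can differ: for [k = 0] they are [phi (1, 1)] and [phi (0, 0)]. *)
have -> : \int[mu]_(s in `[0, 1]) (phi \o iter k (FA 0)) (s, s) = strip phi 0 k 0.
  have ED : {in (`[0, 1[%classic : set (measurableTypeR R)), F 0 =1 fun s => phi (iter k (FA 0) (s, s))}.
    by move=> s; rewrite inE /= in_itv /=; exact: FE.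
  rewrite /= -Rintegral_itv_bndo_bndc.
    rewrite -(@eq_Rintegral _ _ _ _ _ _ _ ED) (Rintegral_itv_bndo_bndc (bmeas_itv 0 1 true true (bF 0))).
    by [].
  apply: (@eq_integrable _ _ _ mu `[0, 1[%classic _ (EFin \o F 0)) => //.
    by move=> s hs /=; rewrite ED.
  exact: (bmeas_itv 0 1 true true (bF 0)).
apply/cvg_at_rightP => tn [tn0 tnc].
have [K K0 HK] := C0M_bounded C.
apply: (@itg_dominated (fun n => F (tn n)) (F 0) K rational_points) => //.
- exact: countable_rational_points.
- by move=> n x; apply: HK; exact: closedM_frac.
move=> u u01 irr.
have [p [q [p0 q0 E c1 c2]]] := @orbit_cvg u tn k u01 irr tnc.
have hu : 0 <= u < 1 by move: u01 => /andP[/ltW -> ->].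
rewrite FE //; under eq_fun do rewrite FE //.
rewrite E.
apply/cvgrPdist_lt => e e0.
have [d d0 H] := C0M_ball C (closedM_frac (p%:R * u) (q%:R * u)) e0.
have n1 : \forall n \near \oo, `|frac (p%:R * u) - (iter k (FA (tn n)) (u, u)).1| < d.
  by move/cvgrPdist_lt : c1; exact.
have n2 : \forall n \near \oo, `|frac (q%:R * u) - (iter k (FA (tn n)) (u, u)).2| < d.
  by move/cvgrPdist_lt : c2; exact.
apply: filterS2 n1 n2 => n h1 h2; apply: H => //.
have -> : iter k (FA (tn n)) (u, u) = fracs (iter k (FA (tn n)) (u, u)).
  by case: (k) => [|m]; [rewrite /fracs /= !frac_id|rewrite iterS fracs_FA].
exact: closedM_frac.
Qed.

End Diagonal.

(** * Assembling the response formula *)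

Lemma cvg_sqrt_close (R : realType) (f g : R -> R) (l K t0 : R) : 0 < t0 -> 0 <= K ->
  (forall t, 0 < t <= t0 -> `|f t - g t| <= K * Num.sqrt t) ->
  g t @[t --> 0^'+] --> l -> f t @[t --> 0^'+] --> l.
Proof.
move=> t00 K0 H gl; apply/cvgrPdist_lt => e e0.
have e20 : 0 < e / 2 by rewrite divr_gt0.
have K1 : 0 < K + 1 by rewrite ltr_wpDl.
pose d := (e / 2 / (K + 1)) ^+ 2.
have d0 : 0 < d by rewrite exprn_gt0 // divr_gt0.
have n1 : \forall t \near 0^'+, `|l - g t| < e / 2 by move/cvgrPdist_lt: gl; exact.
have n2 : \forall t \near 0^'+, 0 < t <= Num.min t0 d.
  near=> t; apply/andP; split; first by near: t; exact: nbhs_right_gt.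
  by near: t; apply: nbhs_right_le; rewrite lt_min t00.
apply: filterS2 n1 n2 => t h1 /andP[tp]; rewrite le_min => /andP[tt td].
have := H t; rewrite tp tt => /(_ isT) h2.
have s : Num.sqrt t <= e / 2 / (K + 1) by apply: sqrt_leP => //; rewrite ltW // divr_gt0.
have h3 : K * Num.sqrt t <= e / 2.
  apply: (le_trans (ler_wpM2l K0 s)).
  by rewrite mulrCA -[leRHS]mulr1 ler_pM2l // ler_pdivrMr // mul1r lerDl.
have -> : l - f t = (l - g t) - (f t - g t) by ring.
apply: (le_lt_trans (ler_normB _ _)); move: h1 h2 h3; clear; lra.
Unshelve. all: by end_near.
Qed.

Theorem theorem5p2 (R : realType) (eps0 : R)
    (mu : R -> {measure set (plane R) -> \bar R})
    (heps0 : 0 < eps0 <= 1 / 8)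
    (hmu : forall t : R, 0 < t <= eps0 -> is_limit_measure t (mu t))
    (phi : R * R -> R) (hphi : C1M phi) :
  cvgn (series (response_term phi)) /\
  (integM (mu t) phi - integM (m2 R) phi) / t @[t --> 0^'+] -->
    limn (series (response_term phi)).
Proof.
have [C _ _ _] := hphi; have /andP[eps00 _] := heps0.
have [r r0 Hr] := initial_bound hphi.
have [t0 [A [q [t00 t01 A0 hq Hd]]]] := leaf_norm_decay R.
have /andP[q0 q1] := hq.
pose t1 := Num.min t0 eps0.
have t10 : 0 < t1 by rewrite lt_min t00.
have B0 : 0 <= 3 * (A * r) by rewrite mulr_ge0 // mulr_ge0.
have bdV t k : 0 < t <= t1 -> exists c, leaf_norm_le c (A * r * q ^+ k) (leafint phi t k 1).
  move=> /andP[tp]; rewrite le_min => /andP[tt _].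
  have ht : time_ok t by apply/andP; split; lra.
  apply: (Hd t ht tt _ _ (family_leafint C ht) r0).
    by move=> a ha; exists 0; exact: Hr.
  by apply/andP; split; lra.
have tle t : 0 < t <= t1 -> 0 < t <= 1/20.
  by move=> /andP[tp]; rewrite le_min => /andP[tt _]; apply/andP; split; lra.
pose a t k := (mean_iter phi t k.+1 - mean_iter phi t k) / t.
have Ha t : 0 < t <= t1 -> forall k, `|a t k| <= 3 * (A * r) * q ^+ k.
  move=> ht k; have [c bV] := bdV t k ht.
  by have := quotient_bound C (tle t ht) bV; rewrite -!mulrA.
have serS t n : series (a t) n.+1 = series (a t) n + a t n.
  by rewrite /series /= big_nat_recr.
(* Telescoping; as [n] grows, the hypothesis on [mu t] identifies the sum of the series. *)
have ser t n : series (a t) n = (mean_iter phi t n - integM (m2 R) phi) / t.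
  elim: n => [|n IH].
    by rewrite /series /= big_geq // /mean_iter subrr mul0r.
  by rewrite serS IH /a -mulrDl; congr (_ / _); ring.
apply: (tannery t10 B0 hq Ha) => [t ht|k].
  rewrite (funext (ser t)); apply: cvgM; last exact: cvg_cst.
  apply: cvgB; last exact: cvg_cst.
  by apply: hmu => //; move: ht => /andP[->]; rewrite le_min => /andP[_ ->].
have Bk : 0 <= A * r * q ^+ k by rewrite !mulr_ge0 ?exprn_ge0 // ltW.
(* The [k] telescoped differences are each at most [3 * (A * r) * t], and [t <= sqrt t]. *)
have c1 : mean_iter phi t k @[t --> 0^'+] --> integM (m2 R) phi.
  apply: (@cvg_sqrt_close _ _ (fun=> integM (m2 R) phi) _ (k%:R * (3 * (A * r))) t1) => //.
  - by rewrite mulr_ge0.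
  - move=> t ht; have /andP[tp tt] := tle t ht.
    have -> : mean_iter phi t k - integM (m2 R) phi = t * series (a t) k.
      by rewrite ser mulrC divfK // gt_eqF.
    rewrite normrM (gtr0_norm tp) mulrC; apply: ler_pM => //; [exact: ltW| |by apply: le_sqrt01; lra].
    elim: (k) => [|j IH]; first by rewrite /series /= big_geq // normr0 mul0r.
    rewrite serS; apply: (le_trans (ler_normD _ _)).
    rewrite -natr1 mulrDl mul1r lerD //; apply: (le_trans (Ha t ht j)).
    by rewrite -[leRHS]mulr1 ler_wpM2l // exprn_ile1 // ltW.
  - exact: cvg_cst.
have c2 : itg (strip phi t k) (1 - t) 1 / t @[t --> 0^'+] -->
   Rintegral (@lebesgue_measure R) `[0, 1] (fun s : R => (phi \o iter k (FA 0)) (s, s)).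
  have K0 : 0 <= 1000 * (A * r * q ^+ k) by move: Bk; set y := A * r * q ^+ k; clear; lra.
  have close t : 0 < t <= t1 -> `|itg (strip phi t k) (1 - t) 1 / t - strip phi t k 0| <=
      1000 * (A * r * q ^+ k) * Num.sqrt t.
    by move=> ht; have [c bV] := bdV t k ht; exact: (strip_end C (tle t ht) bV).
  exact: (cvg_sqrt_close t10 K0 close (strip_diagonal (k := k) C)).
have c3 : (1 - t)^-1 @[t --> (0 : R)^'+] --> (1 : R).
  rewrite -[X in _ --> X]invr1; apply: cvgV => //.
  rewrite -[X in _ --> X]subr0; apply: cvgB; first exact: cvg_cst.
  exact: cvg_at_right_filter cvg_id.
have E : \forall t \near 0^'+, (1 - t)^-1 * (mean_iter phi t k - itg (strip phi t k) (1 - t) 1 / t) = a t k.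
  near=> t; have ht : 0 < t <= t1.
    apply/andP; split; first by near: t; exact: nbhs_right_gt.
    by near: t; exact: nbhs_right_le.
  have [c bV] := bdV t k ht.
  by rewrite /a (quotientE C (tle t ht) bV).
apply: cvg_trans (near_eq_cvg E) _.
rewrite -[response_term phi k]mul1r.
exact: (cvgM c3 (cvgB c1 c2)).
Unshelve. all: by end_near.
Qed.
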